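(* Let $A_i(\varepsilon)=A_i+\varepsilon\Delta^{(i)}\in\mathbb C^{d\times d}$, $i=1,\dots,m$, $\varepsilon\in\mathbb R$, with $\|\Delta^{(i)}\|_F=1$ and each $A_i$ having simple nonzero eigenvalues $\lambda_1^{(i)},\dots,\lambda_d^{(i)}$, and let $p_1,\dots,p_m$ be probability weights. Assume simultaneous triangularizability: there exist $\varepsilon_0>0$ and invertible matrices $S(\varepsilon)$, $|\varepsilon|\le\varepsilon_0$, such that $T_i(\varepsilon):=S(\varepsilon)^{-1}A_i(\varepsilon)S(\varepsilon)$ is upper triangular for all $i$, with diagonal entries $\lambda_j^{(i)}(\varepsilon):=(T_i(\varepsilon))_{jj}$, ordered so that $\lambda_j^{(i)}(0)=\lambda_j^{(i)}$, and $\lambda_j^{(i)}(\varepsilon)\ne0$ for all $i,j$ and $|\varepsilon|\le\varepsilon_0$. Set $$\mu_j(\varepsilon):=\sum_{i=1}^m p_i\log|\lambda_j^{(i)}(\varepsilon)|,\quad\rho_\infty^{(j)}(\varepsilon):=e^{\mu_j(\varepsilon)},\quad \rho_\infty(\varepsilon):=\max_{1\le j\le d}\rho_\infty^{(j)}(\varepsilon),\quad J(\varepsilon):=\arg\max_{1\le j\le d}\rho_\infty^{(j)}(\varepsilon).$$ Let $\rho_n(\varepsilon)$ denote the random spectral radius of length $n$ of $\mathcal F_\varepsilon=\{A_1(\varepsilon),\dots,A_m(\varepsilon)\}$. Then for every fixed $|\varepsilon|\le\varepsilon_0$: 1. $\rho_n(\varepsilon)\to\rho_\infty(\varepsilon)=\max_{1\le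 j\le d}\prod_{i=1}^m|\lambda_j^{(i)}(\varepsilon)|^{p_i}$ almost surely as $n\to\infty$. 2. If $J(\varepsilon)=\{j^\star(\varepsilon)\}$, define $$\sigma_\infty(\varepsilon)=\rho_\infty(\varepsilon)\left(\sum_{i=1}^m p_i\bigl(\log|\lambda_{j^\star(\varepsilon)}^{(i)}(\varepsilon)|\bigr)^2-\mu_{j^\star(\varepsilon)}(\varepsilon)^2\right)^{1/2}.$$ If in addition $\sigma_\infty(\varepsilon)>0$, then $\dfrac{\rho_n(\varepsilon)-\rho_\infty(\varepsilon)}{n^{-1/2}\sigma_\infty(\varepsilon)}\xRightarrow{d}\mathcal N(0,1)$; if instead $\sigma_\infty(\varepsilon)=0$, then $\sqrt n\,(\rho_n(\varepsilon)-\rho_\infty(\varepsilon))\xRightarrow{d}0$. 3. If $|J(\varepsilon)|>1$, then $\sqrt n\,(\rho_n(\varepsilon)-\rho_\infty(\varepsilon))\xRightarrow{d}\rho_\infty(\varepsilon)\max_{j\in J(\varepsilon)}G_j$, where $(G_j)_{j\in J(\varepsilon)}$ is a centered Gaussian vector with covariance matrix $$\Sigma_\varepsilon(l,h):=\sum_{i=1}^m p_i\log|\lambda_l^{(i)}(\varepsilon)|\,\log|\lambda_h^{(i)}(\varepsilon)|-\mu_l(\varepsilon)\mu_h(\varepsilon),\qquad l,h\in J(\varepsilon).$$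
   Context: $p_i\ge0$, $\sum_ip_i=1$. Let $(i_k)_{k\ge1}$ be i.i.d. random indices in $\{1,\dots,m\}$ with $\mathbb P(i_k=i)=p_i$; then $\rho_n(\varepsilon)=\rho_n(\mathcal F_\varepsilon,\mathbb P_{\mathcal F_\varepsilon}):=\rho\bigl(A_{i_n}(\varepsilon)\cdots A_{i_1}(\varepsilon)\bigr)^{1/n}$, where $\rho(\cdot)$ is the spectral radius. The functions $\varepsilon\mapsto\lambda_j^{(i)}(\varepsilon)$ are labelled so that (for small $|\varepsilon|$) they agree with the analytic eigenvalue branches of $A_i(\varepsilon)$ issuing from the simple eigenvalues $\lambda_j^{(i)}$ of $A_i$. Gaussian vectors may be degenerate. *)

(* Defs.v *)
(* MathComp-Analysis; the complex numbers are R[i] over a realType R. *)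
From HB Require Import structures.
From mathcomp Require Export all_boot all_order all_algebra finmap.
From mathcomp Require Export all_classical all_reals all_analysis.
From mathcomp.real_closed Require Export complex.

Set Implicit Arguments.
Unset Strict Implicit.
Unset Printing Implicit Defensive.

Import Order.TTheory GRing.Theory Num.Theory.
Import numFieldNormedType.Exports.

Local Open Scope classical_set_scope.
Local Open Scope ring_scope.

(* The R-valued modulus; the generic norm `|z| of z : R[i] lives in R[i]. *)
Definition cmod (R : realType) (z : R[i]) : R := ComplexField.Normc.normc z.

Section Matrices.
Variables (R : realType) (d : nat).

Definition frobenius_norm (M : 'M[R[i]]_d) : R :=
  Num.sqrt (\sum_(a < d) \sum_(b < d) cmod (M a b) ^+ 2).

(* For 0 < d the set is finite and nonempty, so the supremum is a maximum. *)
Definition spectral_radius (M : 'M[R[i]]_d) : R :=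
  sup [set cmod z | z in [set z | eigenvalue M z]].

(* is_trig_mx is lower triangularity. *)
Definition upper_triangular (M : 'M[R[i]]_d) : bool := is_trig_mx M^T.

(* The listed numbers are the eigenvalues counted with algebraic multiplicity;
   they are simple exactly when the list has no repetition. *)
Definition simple_eigenvalues (M : 'M[R[i]]_d) (lam : 'I_d -> R[i]) : Prop :=
  char_poly M = \prod_(j < d) ('X - (lam j)%:P) /\ injective lam.

(* Real-analyticity near 0 of a complex-valued function: it is the sum of a
   power series, with convergence taken on real and imaginary parts. *)
Definition analytic_near0 (f : R -> R[i]) : Prop :=
  exists (c : nat -> R[i]) (r : R), 0 < r /\
    forall e : R, `|e| < r ->
      series (fun k => complex.Re (c k) * e ^+ k) @ \oo --> complex.Re (f e) /\
      series (fun k => complex.Im (c k) * e ^+ k) @ \oo --> complex.Im (f e).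

Definition analytic_eigenbranch (M : R -> 'M[R[i]]_d) (z : R[i])
    (f : R -> R[i]) : Prop :=
  [/\ analytic_near0 f, f 0 = z & \forall e \near (0 : R), eigenvalue (M e) (f e)].

Definition perturb (A D : 'M[R[i]]_d) (e : R) : 'M[R[i]]_d :=
  A + (e%:C)%C *: D.

(* mxprod B n = B (n-1) * ... * B 0. *)
Fixpoint mxprod (B : nat -> 'M[R[i]]_d) (n : nat) : 'M[R[i]]_d :=
  if n is k.+1 then B k *m mxprod B k else 1%:M.

End Matrices.

Section Exponents.
Variables (R : realType) (m d : nat).
Variables (p : 'I_m -> R) (lam : 'I_m -> 'I_d -> R[i]).

Definition mu_exp (j : 'I_d) : R := \sum_(i < m) p i * ln (cmod (lam i j)).

Definition rho_exp (j : 'I_d) : R := expR (mu_exp j).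

(* The terms are positive, so the default value 0 is immaterial. *)
Definition rho_inf : R := \big[Num.max/0]_(j < d) rho_exp j.

Definition argmax_set : {set 'I_d} :=
  finset (fun j => [forall k, rho_exp k <= rho_exp j]).

Definition Sigma (l h : 'I_d) : R :=
  \sum_(i < m) p i * ln (cmod (lam i l)) * ln (cmod (lam i h))
  - mu_exp l * mu_exp h.

Definition sigma_inf (j : 'I_d) : R :=
  rho_inf * Num.sqrt (\sum_(i < m) p i * ln (cmod (lam i j)) ^+ 2
                      - mu_exp j ^+ 2).

End Exponents.

Section RandomProducts.
Variables (R : realType) (m d : nat).
Context (dT : measure_display) (T : measurableType dT) (P : probability T R).

(* The times start at 0: idx k is the (k+1)-st random index. Independence is the
   product rule over every finite set of times. *)
Definition iid_indices (p : 'I_m -> R) (idx : nat -> T -> 'I_m) : Prop :=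
  [/\ forall k (i : 'I_m), measurable (idx k @^-1` [set i]),
      forall k (i : 'I_m), P (idx k @^-1` [set i]) = (p i)%:E
    & forall (K : {fset nat}) (B : nat -> set 'I_m),
        P (\bigcap_(k in [set` K]) (idx k @^-1` B k)) =
        (\prod_(k <- K) P (idx k @^-1` B k))%E].

Definition rho_n (A : 'I_m -> 'M[R[i]]_d) (idx : nat -> T -> 'I_m)
    (n : nat) (w : T) : R :=
  spectral_radius (mxprod (fun k => A (idx k w)) n) `^ (n%:R^-1).

End RandomProducts.

Section Laws.
Variable R : realType.

(* normal_prob m 0 is not the point mass at m, hence the case distinction. *)
Definition gaussian_law (m s : R) : set (measurableTypeR R) -> \bar R :=
  if s == 0 then \d_m else normal_prob m s.

Definition gaussian_rv (d : measure_display) (T : measurableType d)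
    (P : probability T R) (X : T -> R) : Prop :=
  measurable_fun setT X /\
  exists m s : R, forall A : set (measurableTypeR R), measurable A ->
    P (X @^-1` A) = gaussian_law m s A.

(* Gaussian vector indexed by J, possibly degenerate: every linear combination
   of the components is a possibly degenerate Gaussian variable. *)
Definition centered_gaussian_vector (n : nat) (d : measure_display)
    (T : measurableType d) (P : probability T R) (J : {set 'I_n})
    (G : 'I_n -> T -> R) (S : 'I_n -> 'I_n -> R) : Prop :=
  [/\ forall c : 'I_n -> R,
        gaussian_rv P (fun w => \sum_(j in J) c j * G j w),
      forall j, j \in J -> ('E_P[G j] = 0)%E
    & forall l h, l \in J -> h \in J -> covariance P (G l) (G h) = (S l h)%:E].

(* For nonempty J the supremum is a maximum. *)
Definition max_over (n : nat) (J : {set 'I_n}) (g : 'I_n -> R) : R :=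
  sup [set g j | j in [set j | j \in J]].

(* Convergence in distribution; the variables of the sequence and the limit may
   live on different probability spaces. *)
Definition cvg_in_distribution (d : measure_display) (T : measurableType d)
    (P : probability T R) (X : nat -> T -> R)
    (d' : measure_display) (T' : measurableType d')
    (Q : probability T' R) (Y : T' -> R) : Prop :=
  [/\ forall n, measurable_fun setT (X n), measurable_fun setT Y
    & forall f : R -> R, continuous f -> (exists M, forall x, `|f x| <= M) ->
        'E_P[f \o X n]%E @[n --> \oo] --> 'E_Q[f \o Y]%E].

End Laws.

(* Main.v *)
(* In the triangularizing basis the j-th diagonal entry of a product is the
   product of the diagonal entries, so log rho_n = max_j S_j(n) / n, where S_j(n)
   is a sum of n i.i.d. copies of log |lambda_j|.  Chernoff bounds for S_j and
   Borel-Cantelli give part 1.  The maximum is attained on J outside an event of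
   small probability, and there sqrt n (rho_n - rho) differs from
   rho max_J X_j, with X_j = (S_j - n mu_j) / sqrt n, by O(1 / sqrt n).  It remains
   to pass to the limit in E f (max_J X_j).  Expectations of cos (c.X + b) converge
   to those of the Gaussian limit by direct expansion of the characteristic
   function; those functions span an algebra whose uniform closure is a lattice
   (|h| is a uniform limit of polynomials in h).  On a large box f (max_J x) is
   approximated by such a lattice element with the same sup bound: up to e it is
   the minimum over a grid of f s + K |sin (max_J x / B) - sin (s / B)|, and
   max_J commutes with the increasing sin (./ B).  Tightness of both sides does
   the rest.  The law of a Gaussian vector enters only through its linear
   combinations, whose characteristic function solves u' = - s^2 t u by Stein's
   identity. *)

Require Import Defs.
From mathcomp.algebra_tactics Require Import ring lra.
From mathcomp Require Import measurable_realfun.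

Set Implicit Arguments.
Unset Strict Implicit.
Unset Printing Implicit Defensive.

Import Order.TTheory GRing.Theory Num.Theory.
Import numFieldNormedType.Exports.

Local Open Scope classical_set_scope.
Local Open Scope ring_scope.

(** * Spectral radius of triangularizable products *)

(** The obstacle is the maximum: it is not smooth, and the limit vector may be degenerate, so no
    joint density is available, and only its linear combinations are known. What passes to the limit
    directly is the expectation of cosines of affine forms, hence by linearity of their
    combinations; the rest is approximation. Trigonometric polynomials do not vanish at infinity, so
    [f (max_J x)] can be approximated on a box only, and the mass outside is harmless only if the
    approximant has a global bound fixed before the box is chosen. Uniform density on the box gives
    no such bound; truncation by a minimum does, whence a lattice and not merely an algebra. The
    random side is finite: an event about [n] indices is a set of words of length [n], so
    expectations are finite sums with product weights, and the expectation of a product over letters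
    is an n-th power. As the increments are bounded, one exponential moment bound serves twice: with
    a fixed tilt for the almost sure limit, with a tilt of order [1 / sqrt n] for tightness. *)

Section BigmaxFinite.
Variables (R : realType) (d : nat).
Implicit Types a : 'I_d -> R.

Lemma bigmax0_eq a j : 0 <= a j -> (forall k, a k <= a j) ->
  \big[Num.max/0]_(k < d) a k = a j.
Proof.
move=> aj0 aj; apply/le_anti/andP; split; last exact: (le_bigmax _ a j).
by apply: bigmax_le.
Qed.

Lemma exists_argmax a : (0 < d)%N -> exists j, forall k, a k <= a j.
Proof.
move=> d0; pose j0 := Ordinal d0.
by case: (@arg_maxP _ _ _ j0 xpredT a isT) => j _ h; exists j => k; exact: h.
Qed.

End BigmaxFinite.

Section SpectralRadius.
Variables (R : realType) (d : nat).
Implicit Types S T : 'M[R[i]]_d.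

Lemma upper_triangularP T :
  reflect (forall i j : 'I_d, (j < i)%N -> T i j = 0) (upper_triangular T).
Proof.
apply: (iffP is_trig_mxP) => h i j ij; first by have := h j i ij; rewrite mxE.
by rewrite mxE h.
Qed.

Lemma upper_triangular1 : upper_triangular (1%:M : 'M[R[i]]_d).
Proof.
by apply/upper_triangularP => i j ij; rewrite mxE; case: eqP ij => // ->; rewrite ltnn.
Qed.

Lemma upper_triangularM S T : upper_triangular S -> upper_triangular T ->
  upper_triangular (S *m T).
Proof.
move=> /upper_triangularP hS /upper_triangularP hT; apply/upper_triangularP => i j ij.
rewrite mxE big1// => k _; case: (ltnP k i) => ki; first by rewrite hS ?mul0r.
by rewrite hT ?mulr0// (leq_trans ij).
Qed.

Lemma upper_triangularM_diag S T j : upper_triangular S -> upper_triangular T ->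
  (S *m T) j j = S j j * T j j.
Proof.
move=> /upper_triangularP hS /upper_triangularP hT.
rewrite mxE (bigD1 j)//= big1 ?addr0// => k kj; case: (ltnP k j) => jk.
  by rewrite hS ?mul0r.
by rewrite hT ?mulr0// ltn_neqAle eq_sym kj.
Qed.

Lemma eigenvalue_upper_triangular T z : upper_triangular T ->
  eigenvalue T z = [exists j, z == T j j].
Proof.
move=> hT; rewrite eigenvalue_root_char.
(* [char_poly_trig] concerns lower triangular matrices; transposition preserves the characteristic
   polynomial. *)
have -> : char_poly T = char_poly T^T.
  rewrite /char_poly -det_tr; congr (\det _); apply/matrixP => i j.
  by rewrite !mxE eq_sym.
rewrite char_poly_trig// rootE horner_prod.
apply/prodf_eq0/existsP => [[j _]|[j hj]].
  by rewrite !hornerE mxE subr_eq0 => hj; exists j.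
by exists j => //; rewrite !hornerE mxE subr_eq0.
Qed.

(** Eigenvectors are row vectors here, so they are transported by right multiplication with [S] or
    its inverse. *)
Lemma eigenvalue_conj S T z : S \in unitmx ->
  eigenvalue (S *m T *m invmx S) z = eigenvalue T z.
Proof.
move=> uS; apply/eigenvalueP/eigenvalueP => -[v hv v0].
- exists (v *m S).
    by rewrite scalemxAl -hv -!mulmxA mulVmx// mulmx1 mulmxA.
  by apply: contra_neq v0 => h; rewrite -[v]mulmx1 -(mulmxV uS) mulmxA h mul0mx.
- exists (v *m invmx S).
    by rewrite -!mulmxA (mulmxA _ S) mulVmx// mul1mx mulmxA hv scalemxAl.
  by apply: contra_neq v0 => h; rewrite -[v]mulmx1 -(mulVmx uS) mulmxA h mul0mx.
Qed.

Lemma spectral_radius_triangularizable S T : (0 < d)%N ->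
  S \in unitmx -> upper_triangular T ->
  spectral_radius (S *m T *m invmx S) = \big[Num.max/0]_(j < d) cmod (T j j).
Proof.
move=> d0 uS hT; have [j0 hj0] := exists_argmax (fun j => cmod (T j j)) d0.
rewrite (bigmax0_eq (j := j0))//; last first.
  by rewrite /cmod; case: (T j0 j0) => a b; rewrite sqrtr_ge0.
rewrite /spectral_radius; set E := [set _ | _ in _].
have Ej0 : E (cmod (T j0 j0)).
  exists (T j0 j0) => //=.
  by rewrite eigenvalue_conj// eigenvalue_upper_triangular//; apply/existsP; exists j0.
have ubE : ubound E (cmod (T j0 j0)).
  move=> _ [z /= + <-].
  rewrite eigenvalue_conj// eigenvalue_upper_triangular// => /existsP[j /eqP ->].
  exact: hj0.
apply/le_anti/andP; split; first by apply: sup_le_ub => //; exists (cmod (T j0 j0)).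
by apply: ub_le_sup => //; exists (cmod (T j0 j0)).
Qed.

Lemma mxprod_conj S (A T : nat -> 'M[R[i]]_d) n : S \in unitmx ->
  (forall k, T k = invmx S *m A k *m S) ->
  mxprod A n = S *m mxprod T n *m invmx S.
Proof.
move=> uS hT; elim: n => [|n IH] /=; first by rewrite mulmx1 mulmxV.
by rewrite IH hT !mulmxA mulmxV// mul1mx.
Qed.

Lemma upper_triangular_mxprod (T : nat -> 'M[R[i]]_d) n :
  (forall k, upper_triangular (T k)) -> upper_triangular (mxprod T n).
Proof.
move=> hT; elim: n => [|n IH] /=; first exact: upper_triangular1.
exact: upper_triangularM.
Qed.

Lemma mxprod_diag (T : nat -> 'M[R[i]]_d) n j :
  (forall k, upper_triangular (T k)) ->
  mxprod T n j j = \prod_(k < n) T k j j.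
Proof.
move=> hT; elim: n => [|n IH]; first by rewrite big_ord0 /= mxE eqxx.
rewrite big_ord_recr -IH [RHS]mulrC.
exact: (upper_triangularM_diag _ (hT n) (upper_triangular_mxprod n hT)).
Qed.

End SpectralRadius.

Lemma cmod_gt0 (R : realType) (z : R[i]) : z != 0 -> 0 < cmod z.
Proof.
move=> z0; rewrite lt_neqAle; apply/andP; split; last first.
  by rewrite /cmod; case: z {z0} => a b; rewrite sqrtr_ge0.
by apply: contra_neq z0 => /esym/ComplexField.Normc.eq0_normc.
Qed.

Lemma cmod_prod (R : realType) n (z : 'I_n -> R[i]) :
  cmod (\prod_(k < n) z k) = \prod_(k < n) cmod (z k).
Proof.
elim/big_ind2 : _ => //; first exact: ComplexField.Normc.normc1.
by move=> x y u v <- <-; rewrite /cmod ComplexField.Normc.normcM.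
Qed.

Lemma expR_ln_prod (R : realType) n (x : 'I_n -> R) :
  (forall k, 0 < x k) -> expR (\sum_(k < n) ln (x k)) = \prod_(k < n) x k.
Proof.
move=> x0; rewrite expR_sum; apply: eq_bigr => k _.
by rewrite lnK// posrE.
Qed.

Section RhoN.
Variables (R : realType) (m d : nat) (d0 : (0 < d)%N).
Variables (dT : measure_display) (Omega : measurableType dT).
Variables (A T : 'I_m -> 'M[R[i]]_d) (S : 'M[R[i]]_d).
Hypothesis uS : S \in unitmx.
Hypothesis TE : forall i, T i = invmx S *m A i *m S.
Hypothesis hT : forall i, upper_triangular (T i).
Hypothesis T0 : forall i j, T i j j != 0.

(** One index [j0] attains both maxima, because exp and division by [n] are monotone. For [n = 0]
    both sides are 1, since [0^-1 = 0]. *)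
Lemma rho_nE (idx : nat -> Omega -> 'I_m) n w :
  rho_n A idx n w = \big[Num.max/0]_(j < d)
    expR ((\sum_(k < n) ln (cmod (T (idx k w) j j))) / n%:R).
Proof.
rewrite /rho_n (mxprod_conj (T := fun k => T (idx k w)) _ uS)//.
rewrite spectral_radius_triangularizable//; last exact: upper_triangular_mxprod.
have cE j : cmod (mxprod (fun k => T (idx k w)) n j j) =
    expR (\sum_(k < n) ln (cmod (T (idx k w) j j))).
  rewrite mxprod_diag// cmod_prod expR_ln_prod// => k.
  exact: cmod_gt0.
have [j0 hj0] := exists_argmax
  (fun j => \sum_(k < n) ln (cmod (T (idx k w) j j))) d0.
rewrite (bigmax0_eq (j := j0)); last 2 first.
- by rewrite cE expR_ge0.
- by move=> k; rewrite !cE ler_expR.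
rewrite (bigmax0_eq (j := j0)); last 2 first.
- exact: expR_ge0.
- by move=> k; rewrite ler_expR ler_wpM2r.
by rewrite cE /powR gt_eqF ?expR_gt0// expRK mulrC.
Qed.

End RhoN.

(** * Elementary inequalities *)

Section ElementaryInequalities.
Variable R : realType.
Implicit Types x y s t : R.

Lemma sin_diff_mean_value x y : x < y ->
  exists2 c, x < c < y & sin y - sin x = cos c * (y - x).
Proof.
move=> xy; have [|c] := @MVT R sin cos x y xy (fun t _ => is_derive_sin t).
  by apply: continuous_subspaceT => t; exact: continuous_sin.
by rewrite in_itv/= => cxy ->; exists c.
Qed.

Lemma sin_lipschitz x y : `|sin x - sin y| <= `|x - y|.
Proof.
wlog xy : x y / x < y => [H|].
  have [/H//|/H|->] := ltgtP x y; last by rewrite !subrr normr0.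
  by rewrite distrC (distrC x).
have [c _ h] := sin_diff_mean_value xy.
by rewrite distrC h normrM (distrC x) ler_piMl// ler_norml cos_geN1 cos_le1.
Qed.

Lemma norm_sin_le x : `|sin x| <= `|x|.
Proof. by have := sin_lipschitz x 0; rewrite sin0 !subr0. Qed.

(** The mean value theorem gives a factor [cos c] with [|c| <= 1], and cos is even and decreasing on
    [[0, pi]]. Together with [sin_lipschitz] this makes [|sin x - sin y|] a bounded substitute for
    [|x - y|]. *)
Lemma sin_expanding x y : `|x| <= 1 -> `|y| <= 1 ->
  cos 1 * `|x - y| <= `|sin x - sin y|.
Proof.
wlog xy : x y / x < y => [H|] x1 y1.
  have [/H|/H|->] := ltgtP x y; first exact.
    by rewrite distrC (distrC (sin x)); apply.
  by rewrite !subrr normr0 mulr0.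
have [c /andP[xc cy] h] := sin_diff_mean_value xy.
rewrite (distrC (sin x)) h normrM (distrC x) ler_wpM2r//.
have pi1 : 1 <= pi :> R by rewrite (le_trans _ (pi_ge2 R))// ler1n.
have c1 : `|c| <= 1.
  move: x1 y1; rewrite !ler_norml => /andP[? _] /andP[_ ?].
  by apply/andP; split; apply/ltW; [exact: le_lt_trans xc|exact: lt_le_trans cy _].
have -> : cos c = cos `|c| by case: (ger0P c) => //; rewrite cosN.
apply: le_trans (ler_norm _).
have [->//|c1'] := eqVneq `|c| 1.
by apply/ltW; rewrite ltr_cos ?in_itv/= ?ler01 ?normr_ge0 ?(le_trans c1)// lt_neqAle c1' c1.
Qed.


Lemma cosB1E x : 1 - cos x = (sin (x / 2)) ^+ 2 *+ 2.
Proof.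
have {1}-> : x = (x / 2) *+ 2 by rewrite -mulr_natr divfK.
by rewrite cos_mulr2n; have := cos2Dsin2 (x / 2); lra.
Qed.

Lemma cosB1_bound x : `|cos x - 1| <= x ^+ 2.
Proof.
rewrite distrC cosB1E ger0_norm ?mulrn_wge0 ?sqr_ge0//.
have := norm_sin_le (x / 2) => h.
have : sin (x / 2) ^+ 2 <= (x / 2) ^+ 2.
  by rewrite -real_normK ?num_real// -[leRHS]real_normK ?num_real// lerXn2r ?nnegrE.
by have := sqr_ge0 x; rewrite expr_div_n; lra.
Qed.

(** The derivative [cos x - 1] is of order 2. Here and in the next bounds the constants are not
    sharp; only the order matters. *)
Lemma sin_taylor3 x : `|sin x - x| <= `|x| ^+ 3.
Proof.
wlog x0 : x / 0 < x => [H|].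
  have [/H//|x0|<-] := ltgtP 0 x; last by rewrite sin0 subr0 normr0 expr0n.
  by have := H (- x); rewrite oppr_gt0 sinN normrN -opprD normrN; exact.
have [|c] := @MVT R (fun t => sin t - t) (fun t => cos t - 1) 0 x x0
  (fun t _ => is_deriveB _ _).
  apply: continuous_subspaceT => t; apply: cvgB; first exact: continuous_sin.
  exact: cvg_id.
rewrite in_itv/= sin0 !subr0 => /andP[c0 cx] ->.
rewrite normrM exprSr ler_wpM2r//; apply: (le_trans (cosB1_bound c)).
by rewrite (gtr0_norm x0) lerXn2r ?nnegrE ?ltW.
Qed.

(** With [y = x / 2] the expression is [2 * (y ^+ 2 - sin y ^+ 2)], which splits into a factor of
    order 3 and one of order 1. *)
Lemma cos_taylor4 x : `|cos x - 1 + x ^+ 2 / 2| <= `|x| ^+ 4.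
Proof.
have -> : cos x - 1 + x ^+ 2 / 2 = ((x / 2) - sin (x / 2)) * ((x / 2) + sin (x / 2)) * 2.
  by rewrite -[cos x - 1]opprB cosB1E; field.
set y := x / 2.
have -> : x = 2 * y by rewrite /y; field.
clearbody y.
have h1 : `|y - sin y| <= `|y| ^+ 3 by rewrite distrC sin_taylor3.
have h2 : `|y + sin y| <= 2 * `|y|.
  by rewrite (le_trans (ler_normD _ _))// mulr2n mulrDl mul1r lerD2l norm_sin_le.
rewrite !normrM (ger0_norm (ler0n R 2)).
have h3 := ler_pM (normr_ge0 _) (normr_ge0 _) h1 h2.
apply: (@le_trans _ _ ((`|y| ^+ 3 * (2 * `|y|)) * 2)).
  by rewrite ler_pM2r.
have -> : `|y| ^+ 3 * (2 * `|y|) * 2 = 4 * `|y| ^+ 4 by ring.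
rewrite exprMn.
 apply: ler_wpM2r; first by rewrite exprn_ge0.
by rewrite -natrX ler_nat.
Qed.

Lemma expRN_taylor2 y : 0 <= y -> `|expR (- y) - 1 + y| <= y ^+ 2.
Proof.
move=> y0; have h1 : 0 <= expR (- y) - 1 + y.
  by have := expR_ge1Dx (- y); lra.
rewrite ger0_norm//; have h2 := expR_ge1Dx y; have h3 : 0 < 1 + y by lra.
have h4 : expR (- y) <= (1 + y)^-1 by rewrite expRN lef_pV2 ?posrE ?expR_gt0.
suff : (1 + y)^-1 <= 1 - y + y ^+ 2 by lra.
rewrite -div1r ler_pdivrMr//.
have -> : (1 - y + y ^+ 2) * (1 + y) = 1 + y ^+ 3 by ring.
by rewrite lerDl exprn_ge0.
Qed.

Lemma expR_le_quadratic x : `|x| <= 2^-1 -> expR x <= 1 + x + 2 * x ^+ 2.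
Proof.
rewrite ler_norml => /andP[x1 x2].
have h3 : 0 < 1 - x by lra.
have h4 : expR x <= (1 - x)^-1.
  by rewrite -[x in expR x]opprK expRN lef_pV2 ?posrE ?expR_gt0// expR_ge1Dx.
apply: (le_trans h4); rewrite -div1r ler_pdivrMr//.
have -> : (1 + x + 2 * x ^+ 2) * (1 - x) = 1 + x ^+ 2 * (1 - 2 * x) by ring.
by rewrite lerDl mulr_ge0 ?sqr_ge0//; lra.
Qed.

End ElementaryInequalities.

(** * Characteristic function of a centered finite law *)

Lemma cvg_inv_sqrt (R : realType) :
  (Num.sqrt (n%:R : R))^-1 @[n --> \oo] --> (0 : R).
Proof.
apply/cvgrPdist_le => e e0.
apply: filterS2 (nbhs_infty_gt 0) (nbhs_infty_ger (e ^- 2)) => n n0 hn.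
have sq0 : 0 < Num.sqrt (n%:R : R) by rewrite sqrtr_gt0 ltr0n.
rewrite sub0r normrN ger0_norm ?invr_ge0 ?sqrtr_ge0//.
rewrite -[e]invrK lef_pV2 ?posrE ?invr_gt0//.
by rewrite -[e^-1]gtr0_norm ?invr_gt0// -sqrtr_sqr ler_wsqrtr// exprVn.
Qed.

(** Telescoping. It turns a one-step error of order [n^(-3/2)] between characteristic functions into
    an error of order [n^(-1/2)] for their n-th powers. *)
Lemma normrXB_le (K : numDomainType) (z w : K) n : `|z| <= 1 -> `|w| <= 1 ->
  `|z ^+ n - w ^+ n| <= n%:R * `|z - w|.
Proof.
move=> z1 w1; elim: n => [|n IH]; first by rewrite !expr0 subrr normr0 mul0r.
have -> : z ^+ n.+1 - w ^+ n.+1 = z * (z ^+ n - w ^+ n) + (z - w) * w ^+ n.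
  by rewrite !exprS; ring.
rewrite (le_trans (ler_normD _ _))// -natr1 [leRHS]mulrDl mul1r lerD// normrM.
  by rewrite (le_trans _ IH)// ler_piMl.
by rewrite ler_piMr// normrX exprn_ile1.
Qed.

Section Cis.
Variable R : realType.
Implicit Types s t : R.

Definition cis t : R[i] := (cos t +i* sin t)%C.

Lemma cisD s t : cis (s + t) = cis s * cis t.
Proof. by rewrite /cis cosD sinD; simpc; congr (_ +i* _)%C; ring. Qed.

Lemma cis0 : cis 0 = 1.
Proof. by rewrite /cis cos0 sin0. Qed.

Lemma cis_sum (I : Type) (r : seq I) (F : I -> R) :
  cis (\sum_(k <- r) F k) = \prod_(k <- r) cis (F k).
Proof. by elim/big_ind2 : _ => [|x1 x2 y1 y2 <- <-|//]; rewrite ?cis0 ?cisD. Qed.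

Lemma norm_cis t : `|cis t| = 1.
Proof. by rewrite normc_def /= cos2Dsin2 sqrtr1. Qed.

Lemma normc_le_ReIm (z : R[i]) (a b : R) :
  `|complex.Re z| <= a -> `|complex.Im z| <= b -> `|z| <= ((a + b)%:C)%C.
Proof.
move=> ha hb; have -> : z = ((complex.Re z)%:C)%C + 'i%C * ((complex.Im z)%:C)%C.
  exact: complexE.
have nR (x : R) : `|(x%:C)%C| = ((`|x|)%:C)%C :> R[i].
  by rewrite normc_def /= expr0n addr0 sqrtr_sqr.
have ni : `|'i%C| = 1 :> R[i] by rewrite normc_def /= expr0n expr1n add0r sqrtr1.
rewrite (le_trans (ler_normD _ _))// normrM ni mul1r !nR rmorphD/=.
by rewrite lerD// lecR.
Qed.

End Cis.

Section CenteredFiniteLaw.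
Variables (R : realType) (m : nat) (p v : 'I_m -> R).
Hypothesis p0 : forall i, 0 <= p i.
Hypothesis p1 : \sum_i p i = 1.
Hypothesis pv : \sum_i p i * v i = 0.

Lemma norm_sum_weights_le (g : 'I_m -> R) a : (forall i, `|g i| <= a) ->
  `|\sum_i p i * g i| <= a.
Proof.
move=> ga; rewrite (le_trans (ler_norm_sum _ _ _))//.
rewrite -[leRHS]mul1r -p1 mulr_suml; apply: ler_sum => i _.
by rewrite normrM (ger0_norm (p0 i)) ler_wpM2l.
Qed.

Lemma exists_norm_bound : exists2 K, 1 <= K & forall i, `|v i| <= K.
Proof.
exists (1 + \sum_i `|v i|); first by rewrite lerDl sumr_ge0.
by move=> i; rewrite (bigD1 i)//= addrCA lerDl addr_ge0// sumr_ge0.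
Qed.

(** The one-step characteristic function and its Gaussian counterpart agree to second order, the
    linear term vanishing because [v] is centered. In the constant 3, the remainders of cos and exp
    contribute 2 through the real part, that of sin contributes 1 through the imaginary part;
    [1 <= K] and [s <= 1] bring all of them to the form [K ^+ 4 * s ^+ 3]. *)
Lemma charfun_taylor (K s : R) : 1 <= K -> (forall i, `|v i| <= K) -> 0 <= s <= 1 ->
  `|\sum_i ((p i)%:C)%C * cis (s * v i)
    - ((expR (- (s ^+ 2 * (\sum_i p i * v i ^+ 2) / 2)))%:C)%C|
  <= ((3 * K ^+ 4 * s ^+ 3)%:C)%C.
Proof.
move=> K1 vK /andP[s0 s1]; set V := \sum_i p i * v i ^+ 2.
have K0 : 0 <= K by rewrite (le_trans _ K1).
have V0 : 0 <= V by apply: sumr_ge0 => i _; rewrite mulr_ge0 ?sqr_ge0.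
have VK : V <= K ^+ 2.
  rewrite (le_trans (ler_norm _))//; apply: norm_sum_weights_le => i.
  by rewrite normrX lerXn2r ?nnegrE.
have sv i : `|s * v i| <= s * K by rewrite normrM ger0_norm// ler_wpM2l.
have s43 : s ^+ 4 <= s ^+ 3 by rewrite (exprSr s 3) ler_piMr ?exprn_ge0.
have K34 : K ^+ 3 <= K ^+ 4 by rewrite ler_weXn2l.
have s30 : 0 <= s ^+ 3 by rewrite exprn_ge0.
have K40 : 0 <= K ^+ 4 by rewrite exprn_ge0.
have ReE : complex.Re (\sum_i ((p i)%:C)%C * cis (s * v i)) = \sum_i p i * cos (s * v i).
  rewrite (raddf_sum (@complex.Re R : Rcomplex R -> R)); apply: eq_bigr => i _.
  by rewrite /cis; simpc.
have ImE : complex.Im (\sum_i ((p i)%:C)%C * cis (s * v i)) = \sum_i p i * sin (s * v i).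
  rewrite (raddf_sum (@complex.Im R : Rcomplex R -> R)); apply: eq_bigr => i _.
  by rewrite /cis; simpc.
have -> : 3 * K ^+ 4 * s ^+ 3 = 2 * K ^+ 4 * s ^+ 3 + K ^+ 4 * s ^+ 3 by ring.
apply: normc_le_ReIm; last first.
  rewrite raddfB /= ImE subr0.
  have -> : \sum_i p i * sin (s * v i) = \sum_i p i * (sin (s * v i) - s * v i).
    under [RHS]eq_bigr do rewrite mulrBr mulrCA.
    by rewrite sumrB -mulr_sumr pv mulr0 subr0.
  apply: norm_sum_weights_le => i; rewrite (le_trans (sin_taylor3 _))//.
  apply: (@le_trans _ _ ((s * K) ^+ 3)).
    by rewrite lerXn2r ?nnegrE ?mulr_ge0.
  by rewrite exprMn mulrC ler_wpM2r.
rewrite raddfB /= ReE.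
have -> : \sum_i p i * cos (s * v i) - expR (- (s ^+ 2 * V / 2)) =
    \sum_i p i * (cos (s * v i) - 1 + (s * v i) ^+ 2 / 2)
    - (expR (- (s ^+ 2 * V / 2)) - 1 + s ^+ 2 * V / 2).
  have -> : \sum_i p i * (cos (s * v i) - 1 + (s * v i) ^+ 2 / 2) =
      \sum_i p i * cos (s * v i) - 1 + s ^+ 2 * V / 2.
    have -> : \sum_i p i * cos (s * v i) - 1 =
        \sum_i p i * cos (s * v i) - \sum_i p i by rewrite p1.
    rewrite /V mulr_sumr mulr_suml -sumrB -big_split /=.
    by apply: eq_bigr => i _; rewrite exprMn; field.
  ring.
rewrite (le_trans (ler_normB _ _))//.
have -> : 2 * K ^+ 4 * s ^+ 3 = K ^+ 4 * s ^+ 3 + K ^+ 4 * s ^+ 3 by ring.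
apply: lerD.
  apply: norm_sum_weights_le => i; rewrite (le_trans (cos_taylor4 _))//.
  apply: (@le_trans _ _ ((s * K) ^+ 4)).
    by rewrite lerXn2r ?nnegrE ?mulr_ge0.
  by rewrite exprMn mulrC ler_wpM2l.
rewrite (le_trans (expRN_taylor2 _))//; first by rewrite !mulr_ge0 ?sqr_ge0.
have -> : (s ^+ 2 * V / 2) ^+ 2 = s ^+ 4 * V ^+ 2 / 4 by field.
have V2 : V ^+ 2 <= K ^+ 4.
  by rewrite (exprM K 2 2) lerXn2r ?nnegrE ?sqr_ge0.
have := ler_pM (exprn_ge0 4 s0) (sqr_ge0 V) s43 V2.
have : 0 <= s ^+ 4 * V ^+ 2 by rewrite mulr_ge0 ?sqr_ge0 ?exprn_ge0.
by lra.
Qed.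

(** For [s = 1 / sqrt n] the Gaussian factor [q] satisfies [q ^+ n = expR (- (V / 2))] exactly, so
    only the one-step error matters: taking powers multiplies it by [n], which leaves
    [3 * K ^+ 4 * s]. *)
Lemma charfun_pow_cvg b :
  complex.Re (cis b * (\sum_i ((p i)%:C)%C * cis ((Num.sqrt n%:R)^-1 * v i)) ^+ n)
    @[n --> \oo] --> expR (- ((\sum_i p i * v i ^+ 2) / 2)) * cos b.
Proof.
have [K K1 vK] := exists_norm_bound.
set V := \sum_i p i * v i ^+ 2.
have V0 : 0 <= V by apply: sumr_ge0 => i _; rewrite mulr_ge0 ?sqr_ge0.
apply/cvgrPdist_le => e e0.
have cvg0 : (3 * K ^+ 4) * (Num.sqrt (n%:R : R))^-1 @[n --> \oo] --> (3 * K ^+ 4) * 0.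
  apply: cvgM; first exact: cvg_cst.
  exact: cvg_inv_sqrt.
move: cvg0; rewrite mulr0 => /cvgrPdist_le /(_ e e0).
apply: filterS2 (nbhs_infty_gt 0) => n n0.
rewrite sub0r normrN => hn.
set s := (Num.sqrt n%:R)^-1 in hn *.
have sq0 : 0 < Num.sqrt (n%:R : R) by rewrite sqrtr_gt0 ltr0n.
have s0 : 0 < s by rewrite invr_gt0.
have s1 : s <= 1.
  by rewrite invf_le1// -[leLHS]sqrtr1 ler_wsqrtr// ler1n.
have ns2 : n%:R * s ^+ 2 = 1.
  by rewrite /s exprVn sqr_sqrtr ?ler0n// divff// pnatr_eq0 -lt0n.
set phi := \sum_i _.
set q := expR (- (s ^+ 2 * V / 2)).
have qn : q ^+ n = expR (- (V / 2)).
  rewrite /q -expRM_natl; congr expR.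
  have -> : n%:R * - (s ^+ 2 * V / 2) = - (n%:R * s ^+ 2 * V / 2) by field.
  by rewrite ns2 mul1r.
have phi1 : `|phi| <= 1.
  rewrite (le_trans (ler_norm_sum _ _ _))//.
  have <- : \sum_i ((p i)%:C)%C = 1 :> R[i] by rewrite -rmorph_sum p1.
  apply: ler_sum => i _; rewrite normrM norm_cis mulr1.
  by rewrite ger0_norm// ler0c p0.
have q1 : `|(q%:C)%C| <= 1 :> R[i].
  rewrite ger0_norm ?ler0c ?expR_ge0//.
  rewrite (_ : 1 = (1%:C)%C)// lecR.
rewrite expR_le1 oppr_le0.
  by apply: divr_ge0 => //; apply: mulr_ge0 => //; exact: sqr_ge0.
have := charfun_taylor K1 vK (introT andP (conj (ltW s0) s1)).
rewrite -/V -/phi -/q => hq.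
have hb : expR (- (V / 2)) * cos b = complex.Re (cis b * (q%:C)%C ^+ n).
  by rewrite -rmorphXn/= qn /cis; simpc; rewrite mulrC.
rewrite hb.
have -> : complex.Re (cis b * (q%:C)%C ^+ n) - complex.Re (cis b * phi ^+ n) =
  complex.Re (cis b * ((q%:C)%C ^+ n - phi ^+ n)).
  by rewrite mulrBr raddfB.
rewrite -lecR (le_trans (normc_ge_Re _))// normrM norm_cis mul1r distrC.
rewrite (le_trans (normrXB_le n phi1 q1))//.
apply: (@le_trans _ _ (n%:R * ((3 * K ^+ 4 * s ^+ 3)%:C)%C)).
  by rewrite ler_wpM2l.
rewrite -[n%:R](rmorph_nat (real_complex R)) -rmorphM/= lecR.
apply: le_trans hn; rewrite (le_trans _ (ler_norm _))//.
have -> : n%:R * (3 * K ^+ 4 * s ^+ 3) = 3 * K ^+ 4 * s * (n%:R * s ^+ 2) by ring.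
by rewrite ns2 mulr1.
Qed.

(** Averaging the quadratic upper bound of exp kills the linear term, and [1 + t <= expR t] restores
    an exponential, which behaves well under n-th powers. *)
Lemma mgf_le (K s : R) : (forall i, `|v i| <= K) -> `|s| * K <= 2^-1 ->
  \sum_i p i * expR (s * v i) <= expR (2 * s ^+ 2 * K ^+ 2).
Proof.
move=> vK sK.
have K0 (i : 'I_m) : 0 <= K by rewrite (le_trans _ (vK i)).
have sv i : `|s * v i| <= 2^-1.
  by rewrite normrM (le_trans _ sK)// ler_wpM2l.
apply: (@le_trans _ _ (\sum_i (p i + s * (p i * v i) + p i * (2 * s ^+ 2 * K ^+ 2)))).
  apply: ler_sum => i _.
  have -> : p i + s * (p i * v i) + p i * (2 * s ^+ 2 * K ^+ 2) =
    p i * (1 + s * v i + 2 * (s ^+ 2 * K ^+ 2)) by ring.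
  rewrite ler_wpM2l// (le_trans (expR_le_quadratic (sv i)))// lerD2l ler_wpM2l//.
  rewrite exprMn ler_wpM2l ?sqr_ge0// -real_normK ?num_real// lerXn2r ?nnegrE//.
  exact: K0 i.
rewrite !big_split /= p1 -mulr_sumr pv mulr0 addr0 -mulr_suml p1 mul1r.
exact: expR_ge1Dx.
Qed.

End CenteredFiniteLaw.

(** * Bounded random variables and random words *)

Section BoundedIntegrals.
Context (R : realType) (dT : measure_display) (Omega : measurableType dT).
Variable P : probability Omega R.
Implicit Types f g : Omega -> R.

Lemma integrable_bounded f M : measurable_fun setT f ->
  (forall w, `|f w| <= M) -> P.-integrable setT (EFin \o f).
Proof.
move=> mf fM; apply: measurable_bounded_integrable => //.
  by rewrite (le_lt_trans (probability_le1 _ _))// ltry.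
exists M; split; first exact: num_real.
by move=> N MN w _; rewrite /= (le_trans (fM w))// ltW.
Qed.

Lemma expectationE_bounded f M : measurable_fun setT f ->
  (forall w, `|f w| <= M) -> ('E_P[f] = (\int[P]_w f w)%:E)%E.
Proof.
move=> mf fM; rewrite unlock /Rintegral fineK//.
apply: integrable_fin_num => //; exact: integrable_bounded mf fM.
Qed.

Lemma Rintegral_prob_cst (c : R) : \int[P]_w c = c.
Proof.
rewrite Rintegral_cst// [X in fine X](_ : _ = 1%E) ?mulr1//.
exact: probability_setT.
Qed.

(** [|f - g|] is at most [e + 2 * M * \1_B]. This is how an approximation on a box is transferred to
    expectations, with [B] the event of leaving the box. *)
Lemma Rintegral_dist_le f g M e (B : set Omega) :
  measurable_fun setT f -> measurable_fun setT g -> measurable B ->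
  (forall w, `|f w| <= M) -> (forall w, `|g w| <= M) -> 0 <= e ->
  (forall w, ~ B w -> `|f w - g w| <= e) ->
  `|\int[P]_w f w - \int[P]_w g w| <= e + 2 * M * fine (P B).
Proof.
move=> mf mg mB fM gM e0 fg.
have fi := integrable_bounded mf fM; have gi := integrable_bounded mg gM.
have fgM w : `|f w - g w| <= M + M by rewrite (le_trans (ler_normB _ _))// lerD.
have fgi : P.-integrable setT (EFin \o (fun w => f w - g w)).
  by apply: integrable_bounded fgM; exact: measurable_funB.
have afgi : P.-integrable setT (EFin \o (fun w => `|f w - g w|)).
  apply: (@integrable_bounded _ (M + M)); last by move=> w; rewrite normr_id.
  by apply: measurableT_comp => //; exact: measurable_funB.
have iB : P.-integrable setT (EFin \o \1_B).
  apply: (@integrable_bounded _ 1); first exact: measurable_indic.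
  by move=> w; rewrite indicE normr_nat lern1 leq_b1.
have iB' : P.-integrable setT (EFin \o (fun w => 2 * M * \1_B w)).
  apply: (@integrable_bounded _ (`|2 * M| * 1)).
    by apply: measurable_funM => //; exact: measurable_indic.
  by move=> w; rewrite normrM ler_wpM2l// indicE normr_nat lern1 leq_b1.
have ie : P.-integrable setT (EFin \o (fun w => e)).
  by apply: (@integrable_bounded _ `|e|).
rewrite -RintegralB// (le_trans (le_normr_Rintegral _ _))//.
have <- : \int[P]_w (e + 2 * M * \1_B w) = e + 2 * M * fine (P B).
  rewrite RintegralD// RintegralZl// Rintegral_prob_cst; congr (_ + _ * _).
  by rewrite /Rintegral integral_indic// setIT.
apply: le_Rintegral => //.
  apply: (@integrable_bounded _ (`|e| + `|2 * M| * 1)).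
    by apply: measurable_funD => //; apply: measurable_funM => //; exact: measurable_indic.
  move=> w; rewrite (le_trans (ler_normD _ _))// lerD2l normrM ler_wpM2l//.
  by rewrite indicE normr_nat lern1 leq_b1.
move=> w _; rewrite indicE; have [wB|wB] := boolP (w \in B).
  rewrite mulr1 (le_trans (fgM w))// -[leLHS]add0r lerD//.
  by rewrite mulr2n mulrDl mul1r.
by rewrite mulr0 addr0 fg// => Bw; move/negP : wB; apply; exact: mem_set.
Qed.

Lemma integral_finite_sum (I : Type) (r : seq I) (Q : pred I) (f : I -> Omega -> R) :
  (forall i, Q i -> P.-integrable setT (EFin \o f i)) ->
  P.-integrable setT (EFin \o (fun w => \sum_(i <- r | Q i) f i w)) /\
  \int[P]_w (\sum_(i <- r | Q i) f i w) = \sum_(i <- r | Q i) \int[P]_w f i w.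
Proof.
move=> fi; elim: r => [|i r [IH1 IH2]].
  rewrite big_nil; under eq_Rintegral do rewrite big_nil.
  rewrite Rintegral_prob_cst; split => //.
  by under eq_fun do rewrite big_nil; apply: (@integrable_bounded (fun=> 0) 0) => // w; rewrite normr0.
rewrite big_cons; under eq_Rintegral do rewrite big_cons.
under eq_fun do rewrite big_cons.
have [Qi|nQi] := boolP (Q i); last by split.
split; first exact: (integrableD measurableT (fi i Qi) IH1).
by rewrite RintegralD ?IH2//; exact: fi.
Qed.

Lemma fine_prob_le (A B : set Omega) : measurable A -> measurable B -> A `<=` B ->
  fine (P A) <= fine (P B).
Proof.
move=> mA mB AB; apply: fine_le; rewrite ?fin_num_measure//.
by apply: le_measure; rewrite ?inE.
Qed.

Lemma measurable_norm_gt f (B : R) : measurable_fun setT f ->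
  measurable [set w | B < `|f w|].
Proof.
move=> mf; have mnf : measurable_fun setT (fun w => `|f w|) by exact: measurableT_comp.
have := mnf measurableT _ (measurable_itv `]B, +oo[).
rewrite setTI; congr measurable; apply/seteqP.
by split=> w; rewrite /= in_itv/= andbT.
Qed.

(** Continuity from above of [P] along the tail events, which decrease to the empty set because [f]
    is finite everywhere. *)
Lemma tight_random_variable f e : measurable_fun setT f -> 0 < e ->
  \forall B \near +oo, fine (P [set w | B < `|f w|]) <= e.
Proof.
move=> mf e0; pose F (B : R) := [set w | B < `|f w|].
have mF B : measurable (F B) by exact: measurable_norm_gt.
have : P (F N%:R) @[N --> \oo] --> P (\bigcap_N F N%:R).
  apply: nonincreasing_cvg_mu => //.
  - by rewrite (le_lt_trans (probability_le1 _ _))// ltry.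
  - exact: bigcapT_measurable.
  - move=> a b ab; apply/subsetPset => w; apply: le_lt_trans.
    by rewrite ler_nat.
have -> : \bigcap_N F N%:R = set0.
  rewrite -subset0 => w Fw; have := Fw (Num.truncn `|f w|).+1 I.
  rewrite /F /= ltNge => /negP; apply.
  by rewrite ltW// truncnS_gt.
rewrite measure0 => /fine_cvgP[_ /cvgrPdist_le /(_ e e0)] [N _ hN].
have := hN N (leqnn N); rewrite /= sub0r normrN ger0_norm ?fine_ge0// => hP.
apply: filterS (nbhs_pinfty_ge (num_real (N%:R : R))) => B NB.
rewrite (le_trans _ hP)//; apply: fine_prob_le; [exact: mF|exact: mF|].
by move=> w; apply: le_lt_trans.
Qed.

End BoundedIntegrals.

Section Words.
Context (R : realType) (m : nat) (p : 'I_m -> R).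
Context (dT : measure_display) (Omega : measurableType dT).
Variables (P : probability Omega R) (idx : nat -> Omega -> 'I_m).
Hypothesis hidx : iid_indices P p idx.

(** A function of the first [n] indices factors through this finite type, so it is simple:
    measurable, bounded, and integrated by a finite sum. *)
Definition word n (w : Omega) : {ffun 'I_n -> 'I_m} := [ffun k : 'I_n => idx k w].

(** Puts the event in the form required by the product rule of [iid_indices]: a finite set of times
    and one set of letters per time, with [setT] where [insub] fails. *)
Lemma word_preimage n (g : {ffun 'I_n -> 'I_m}) :
  word n @^-1` [set g] = \bigcap_(k in [set` [fset val i | i in 'I_n]%fset])
    (idx k @^-1` (if insub k is Some i then [set g i] else setT)).
Proof.
apply/seteqP; split=> [w /= <- k /= /imfsetP[i _ ->]|w h].
  by rewrite valK /= ffunE.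
apply/ffunP => i; rewrite ffunE; have := h (val i).
by rewrite /= valK; apply; apply/imfsetP; exists i.
Qed.

Lemma measurable_word_preimage n (B : set {ffun 'I_n -> 'I_m}) :
  measurable (word n @^-1` B).
Proof.
have [midx _ _] := hidx.
have -> : word n @^-1` B = \bigcup_(g in B) (word n @^-1` [set g]).
  apply/seteqP; split=> [w Bw|w [g Bg wg]].
    by exists (word n w).
  by rewrite /preimage /= wg.
apply: fin_bigcup_measurable; first exact: finite_finset.
move=> g _; rewrite word_preimage; apply: fin_bigcap_measurable => //.
move=> k _; case: insubP => [i _ _|_]; first exact: midx.
by rewrite preimage_setT.
Qed.

Lemma prob_word n (g : {ffun 'I_n -> 'I_m}) :
  P (word n @^-1` [set g]) = (\prod_k p (g k))%:E.
Proof.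
have [_ hp hind] := hidx.
rewrite word_preimage hind big_imfset/=; last by move=> i j _ _; exact: val_inj.
rewrite -prodEFin big_enum /=; apply: eq_bigr => i _.
by rewrite valK hp.
Qed.

Lemma measurable_word_fun n (F : {ffun 'I_n -> 'I_m} -> R) :
  measurable_fun setT (F \o word n).
Proof.
by move=> _ B mB; rewrite setTI comp_preimage; exact: measurable_word_preimage.
Qed.

Lemma word_fun_sum n (F : {ffun 'I_n -> 'I_m} -> R) w :
  F (word n w) = \sum_g F g * \1_(word n @^-1` [set g]) w.
Proof.
rewrite (bigD1 (word n w))//= indicE mem_set// mulr1 big1 ?addr0// => g hg.
by rewrite indicE memNset ?mulr0//= => /esym/eqP; apply/negP.
Qed.

Lemma Rintegral_word n (F : {ffun 'I_n -> 'I_m} -> R) :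
  \int[P]_w F (word n w) =
  \sum_(g : {ffun 'I_n -> 'I_m}) (\prod_k p (g k)) * F g.
Proof.
have ind g : P.-integrable setT (EFin \o \1_(word n @^-1` [set g])).
  apply: (@integrable_bounded _ _ _ _ _ 1).
    exact/measurable_indic/measurable_word_preimage.
  by move=> w; rewrite indicE normr_nat lern1 leq_b1.
rewrite /Rintegral; under eq_integral do rewrite word_fun_sum -sumEFin.
rewrite integral_sum//; last first.
  move=> g; under eq_fun do rewrite EFinM.
  by apply: integrableZl => //; exact: ind.
rewrite (eq_bigr (fun g : {ffun 'I_n -> 'I_m} => ((\prod_k p (g k)) * F g)%:E)) ?sumEFin// => g _.
under eq_integral do rewrite EFinM.
rewrite integralZl//; last exact: ind.
rewrite integral_indic// ?setIT; last exact: measurable_word_preimage.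
rewrite [in RHS]mulrC EFinM; congr (_ * _)%E; exact: prob_word.
Qed.

Lemma word_fun_bounded n (F : {ffun 'I_n -> 'I_m} -> R) :
  exists M, forall w, `|F (word n w)| <= M.
Proof.
exists (\sum_g `|F g|) => w.
by rewrite (bigD1 (word n w))//= lerDl sumr_ge0.
Qed.

End Words.

(** * Sums along a random word *)

Section WordSums.
Context (R : realType) (m : nat) (p : 'I_m -> R).
Context (dT : measure_display) (Omega : measurableType dT).
Variables (P : probability Omega R) (idx : nat -> Omega -> 'I_m).
Hypothesis hidx : iid_indices P p idx.

(** Expansion of a power of a sum over words. The ring is general because exponential moments use it
    over [R] and characteristic functions over [R[i]]. *)
Lemma sum_words_prod (K : comNzRingType) (q u : 'I_m -> K) n :
  \sum_(g : {ffun 'I_n -> 'I_m}) (\prod_k q (g k)) * (\prod_k u (g k)) =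
  (\sum_i q i * u i) ^+ n.
Proof.
rewrite -[n in RHS]card_ord -prodr_const.
rewrite (bigA_distr_bigA (fun (_ : 'I_n) i => q i * u i)).
by apply: eq_bigr => g _; rewrite big_split.
Qed.

Definition partial_sum (v : 'I_m -> R) n (w : Omega) : R :=
  \sum_(k < n) v (idx k w).

Lemma partial_sum_word v n w :
  partial_sum v n w = \sum_(k < n) v (word idx n w k).
Proof. by apply: eq_bigr => k _; rewrite ffunE. Qed.

Lemma measurable_partial_sum_event v n (C : set R) :
  measurable [set w | C (partial_sum v n w)].
Proof.
rewrite (_ : mkset _ = word idx n @^-1`
  [set g : {ffun 'I_n -> 'I_m} | C (\sum_(k < n) v (g k))]).
  exact: (measurable_word_preimage hidx).
by apply/seteqP; split=> w; rewrite /preimage /= partial_sum_word.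
Qed.

Lemma measurable_partial_sum v n : measurable_fun setT (partial_sum v n).
Proof.
rewrite (_ : partial_sum v n =
  (fun g : {ffun 'I_n -> 'I_m} => \sum_(k < n) v (g k)) \o word idx n).
  exact: (measurable_word_fun hidx).
by apply/funext => w /=; exact: partial_sum_word.
Qed.

Lemma Rintegral_expR_partial_sum v s n :
  \int[P]_w expR (s * partial_sum v n w) = (\sum_i p i * expR (s * v i)) ^+ n.
Proof.
under eq_Rintegral do rewrite partial_sum_word.
rewrite (Rintegral_word hidx (fun g : {ffun 'I_n -> 'I_m} => expR (s * \sum_(k < n) v (g k)))).
rewrite -sum_words_prod; apply: eq_bigr => g _.
by rewrite mulr_sumr expR_sum.
Qed.

Lemma Rintegral_cos_partial_sum v s b n :
  \int[P]_w cos (s * partial_sum v n w + b) =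
  complex.Re (cis b * (\sum_i ((p i)%:C)%C * cis (s * v i)) ^+ n).
Proof.
under eq_Rintegral do rewrite partial_sum_word.
rewrite (Rintegral_word hidx
  (fun g : {ffun 'I_n -> 'I_m} => cos (s * (\sum_(k < n) v (g k)) + b))).
rewrite -sum_words_prod mulr_sumr (raddf_sum (@complex.Re R : Rcomplex R -> R)).
apply: eq_bigr => g _ /=.
rewrite -cis_sum -mulr_sumr mulrCA -cisD addrC -rmorph_prod /= /cis.
by rewrite mulrC; simpc; rewrite mulrC.
Qed.

Hypothesis p0 : forall i, 0 <= p i.
Hypothesis p1 : \sum_i p i = 1.

(** Markov's inequality for the exponential of [s] times the sum, whose expectation is an n-th power
    controlled by [mgf_le]. The tilt [s] stays free, since its two uses need different orders of
    magnitude. *)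
Lemma chernoff v (K s a : R) n : \sum_i p i * v i = 0 -> (forall i, `|v i| <= K) ->
  0 <= s -> s * K <= 2^-1 ->
  fine (P [set w | a <= partial_sum v n w]) <=
  expR (2 * s ^+ 2 * K ^+ 2 * n%:R - s * a).
Proof.
move=> pv vK s0 sK; set A := [set w | _].
have mA : measurable A := measurable_partial_sum_event v n [set x | a <= x].
have -> : fine (P A) = \int[P]_w \1_A w by rewrite /Rintegral integral_indic// setIT.
have mE : measurable_fun setT (fun w => expR (s * partial_sum v n w)).
  apply: measurableT_comp => //; apply: measurable_funM => //.
  exact: measurable_partial_sum.
have iE : P.-integrable setT (EFin \o (fun w => expR (s * partial_sum v n w))).
  have [M hM] := word_fun_bounded idx
    (fun g : {ffun 'I_n -> 'I_m} => expR (s * \sum_(k < n) v (g k))).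
  apply: (@integrable_bounded _ _ _ _ _ M) => // w.
  by rewrite partial_sum_word.
apply: (@le_trans _ _ (\int[P]_w (expR (- (s * a)) * expR (s * partial_sum v n w)))).
  apply: le_Rintegral => //.
  - apply: (@integrable_bounded _ _ _ _ _ 1); first exact: measurable_indic.
    by move=> w; rewrite indicE normr_nat lern1 leq_b1.
  - exact: (integrableZl measurableT (expR (- (s * a))) iE).
  - move=> w _; rewrite -expRD indicE.
    have [/set_mem wA|_] := boolP (w \in A); last exact: expR_ge0.
    rewrite /= (le_trans _ (expR_ge1Dx _))// lerDl addrC subr_ge0.
    exact: ler_wpM2l.
rewrite RintegralZl// Rintegral_expR_partial_sum expRD mulrC ler_wpM2r ?expR_ge0//.
rewrite mulrC expRM_natl lerXn2r ?nnegrE ?expR_ge0//.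
  by apply: sumr_ge0 => i _; rewrite mulr_ge0 ?expR_ge0.
by apply: mgf_le => //; rewrite ger0_norm.
Qed.

Lemma chernoff_abs v (K s a : R) n : \sum_i p i * v i = 0 -> (forall i, `|v i| <= K) ->
  0 <= s -> s * K <= 2^-1 ->
  fine (P [set w | a <= `|partial_sum v n w|]) <=
  2 * expR (2 * s ^+ 2 * K ^+ 2 * n%:R - s * a).
Proof.
move=> pv vK s0 sK.
have pNv : \sum_i p i * - v i = 0.
  by under eq_bigr do rewrite mulrN; rewrite sumrN pv oppr0.
have NvK i : `|- v i| <= K by rewrite normrN.
have mA u : measurable [set w | a <= partial_sum u n w].
  exact: (measurable_partial_sum_event u n [set x | a <= x]).
have mB : measurable [set w | a <= `|partial_sum v n w|].
  exact: (measurable_partial_sum_event v n [set x | a <= `|x|]).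
have h1 := chernoff a n pv vK s0 sK; have h2 := chernoff a n pNv NvK s0 sK.
apply: (@le_trans _ _ (fine (P [set w | a <= partial_sum v n w]) +
    fine (P [set w | a <= partial_sum (fun i => - v i) n w]))); last first.
  by rewrite mulr2n mulrDl mul1r lerD.
apply: (@le_trans _ _ (fine (P ([set w | a <= partial_sum v n w] `|`
    [set w | a <= partial_sum (fun i => - v i) n w])))).
  apply: fine_prob_le => //; first exact: measurableU.
  move=> w /=; rewrite ler_normr => /orP[h|h]; [by left|right].
  by rewrite /partial_sum sumrN.
rewrite -fineD ?fin_num_measure//; apply: fine_le.
- by rewrite fin_num_measure//; exact: measurableU.
- by rewrite fin_numD !fin_num_measure.
- exact: measureU2.
Qed.

End WordSums.

Lemma nneseries_le_geometric (R : realType) (u : nat -> \bar R) (q : R) :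
  0 <= q < 1 -> (forall n, (0 <= u n <= (2 * q ^+ n)%:E)%E) ->
  (\sum_(n <oo) u n < +oo)%E.
Proof.
move=> /andP[q0 q1] hu.
apply: (@le_lt_trans _ _ (2 * (1 - q)^-1)%:E); last exact: ltry.
apply: lime_le.
  by apply: is_cvg_nneseries => n _ _; have /andP[] := hu n.
apply: nearW => n; apply: (@le_trans _ _ (\sum_(0 <= k < n) (2 * q ^+ k)%:E)%E).
  by apply: lee_sum => k _; have /andP[] := hu k.
rewrite sumEFin lee_fin -mulr_sumr ler_pM2l//.
have q1' : 0 < 1 - q by rewrite subr_gt0.
rewrite -div1r ler_pdivlMr// mulrC big_mkord -[1 - q]opprB mulNr -subrX1 opprB.
by rewrite gerBl exprn_ge0.
Qed.

(** * Strong law and tightness for sums along a random word *)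

Section LimitLaws.
Context (R : realType) (m : nat) (p : 'I_m -> R).
Context (dT : measure_display) (Omega : measurableType dT).
Variables (P : probability Omega R) (idx : nat -> Omega -> 'I_m).
Hypothesis hidx : iid_indices P p idx.
Hypothesis p0 : forall i, 0 <= p i.
Hypothesis p1 : \sum_i p i = 1.
Variable v : 'I_m -> R.
Hypothesis pv : \sum_i p i * v i = 0.

Lemma partial_sum_eventually_lt e : 0 < e ->
  {ae P, forall w, \forall n \near \oo, `|partial_sum idx v n w| < n%:R * e}.
Proof.
move=> e0; have [K K1 vK] := exists_norm_bound v.
have K0 : 0 < K by rewrite (lt_le_trans _ K1).
pose A n := [set w | n%:R * e <= `|partial_sum idx v n w|].
have mA n : measurable (A n).
  exact: (measurable_partial_sum_event hidx v n [set x | n%:R * e <= `|x|]).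
(* The first bound is the range of the Chernoff estimate; the second lets the quadratic term consume
   at most half of [s * e], so the probabilities decay geometrically. *)
pose s := Num.min ((2 * K)^-1) (e / (4 * K ^+ 2)).
have K2 : 0 < 4 * K ^+ 2 by rewrite mulr_gt0 ?exprn_gt0.
have s0 : 0 < s by rewrite /s lt_min invr_gt0 mulr_gt0// divr_gt0.
have sK : s * K <= 2^-1.
  rewrite (_ : 2^-1 = (2 * K)^-1 * K); last by rewrite invfM mulfVK// gt_eqF.
  by apply: ler_wpM2r; [exact: ltW|rewrite /s ge_min lexx].
have sK2 : 2 * s ^+ 2 * K ^+ 2 <= s * e / 2.
  have : s * (4 * K ^+ 2) <= e by rewrite -ler_pdivlMr// /s ge_min lexx orbT.
  move=> /(ler_wpM2l (ltW s0)) h.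
  have -> : 2 * s ^+ 2 * K ^+ 2 = (s * (s * (4 * K ^+ 2))) / 2 by field.
  by rewrite ler_pM2r.
have PA n : fine (P (A n)) <= 2 * expR (- (s * e / 2)) ^+ n.
  rewrite (le_trans (chernoff_abs hidx p0 p1 _ _ pv vK (ltW s0) sK))//.
  rewrite ler_wpM2l// -expRM_natl ler_expR.
  have := ler_wpM2r (ler0n R n) sK2; lra.
have : P (lim_sup_set A) = 0%E.
  apply: lim_sup_set_cvg0 => //.
  apply: (@nneseries_le_geometric _ _ (expR (- (s * e / 2)))).
    by rewrite expR_ge0/= expR_lt1 oppr_lt0 !mulr_gt0.
  move=> n; rewrite measure_ge0/=.
  by rewrite -[X in (X <= _)%E]fineK ?fin_num_measure// lee_fin PA.
move=> PA0; exists (lim_sup_set A); split => //.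
  apply: bigcapT_measurable => n; exact: bigcup_measurable.
move=> w /= hw n _; apply: contrapT => hn; apply: hw.
exists n => // k /= nk; rewrite ltNge; apply/negP => Akw.
by apply: hn; exists k.
Qed.

Theorem strong_law :
  {ae P, forall w, partial_sum idx v n w / n%:R @[n --> \oo] --> (0 : R)}.
Proof.
(* Countably many tolerances [1 / (r + 1)] suffice, so the exceptional sets still have a negligible
   union. *)
have h (r : nat) := partial_sum_eventually_lt (divr_gt0 (@ltr01 R) (ltr0Sn R r)).
move: h => /ae_foralln; apply: filterS => w hw.
apply/cvgrPdist_le => e e0.
have [r hr] : exists r : nat, 1 / r.+1%:R <= e.
  exists (Num.truncn e^-1); rewrite div1r -[e]invrK lef_pV2 ?posrE ?invr_gt0//.
  by rewrite ltW// invrK truncnS_gt.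
apply: filterS2 (hw r) (nbhs_infty_gt 0) => n hn n0.
rewrite sub0r normrN normrM normfV (ger0_norm (ler0n R n)).
rewrite ler_pdivrMr ?ltr0n// (le_trans (ltW hn))// mulrC.
by rewrite ler_pM2r ?ltr0n.
Qed.

(** With tilt [1 / (2 * K * sqrt n)] the Chernoff exponent becomes [2^-1 - B / (2 * K)], independent
    of [n]; hence one [B] for all [n]. *)
Lemma scaled_partial_sum_tight e : 0 < e -> \forall B \near +oo, forall n : nat,
  fine (P [set w | B < `|partial_sum idx v n w / Num.sqrt n%:R|]) <= e.
Proof.
move=> e0; have [K K1 vK] := exists_norm_bound v.
have K0 : 0 < K by rewrite (lt_le_trans _ K1).
(* Solution of [2 * expR (2^-1 - B / (2 * K)) = e]. *)
pose B0 : R := 2 * K * (2^-1 - ln (e / 2)).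
apply: filterS2 (nbhs_pinfty_ge (num_real B0)) (nbhs_pinfty_ge (num_real (0 : R))).
move=> B hB B_ge0 n.
have [->|n0] := posnP n.
  rewrite (_ : mkset _ = set0) ?measure0 ?ltW//.
  rewrite -subset0 => w /=; rewrite /partial_sum big_ord0 mul0r normr0.
  by rewrite ltNge B_ge0.
set r := Num.sqrt (n%:R : R).
have r0 : 0 < r by rewrite sqrtr_gt0 ltr0n.
have r1 : 1 <= r by rewrite -[leLHS]sqrtr1 ler_wsqrtr// ler1n.
have r2 : r ^+ 2 = n%:R by rewrite sqr_sqrtr.
apply: (@le_trans _ _ (fine (P [set w | r * B <= `|partial_sum idx v n w|]))).
  apply: fine_prob_le.
  - exact: (measurable_partial_sum_event hidx v n [set x | B < `|x / r|]).
  - exact: (measurable_partial_sum_event hidx v n [set x | r * B <= `|x|]).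
  - move=> w /=; rewrite normrM normfV (gtr0_norm r0) ltr_pdivlMr// mulrC.
    exact: ltW.
have sK : (2 * K * r)^-1 * K <= 2^-1.
  rewrite (_ : (2 * K * r)^-1 * K = 2^-1 / r); last by field; rewrite !gt_eqF.
  by rewrite ler_piMr// invf_le1.
have s0 : 0 <= (2 * K * r)^-1 by rewrite invr_ge0 !mulr_ge0 ?ltW.
rewrite (le_trans (chernoff_abs hidx p0 p1 _ _ pv vK s0 sK))//.
rewrite mulrC -ler_pdivlMr// -[leRHS]lnK ?posrE ?divr_gt0// ler_expR.
have -> : 2 * (2 * K * r)^-1 ^+ 2 * K ^+ 2 * n%:R - (2 * K * r)^-1 * (r * B) =
   2^-1 - B / (2 * K).
  by rewrite -r2; field; rewrite !gt_eqF.
rewrite lerBlDr -lerBlDl ler_pdivlMr ?mulr_gt0//.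
by rewrite mulrC.
Qed.

End LimitLaws.

(** * Uniform closure of an algebra of functions *)

(** Heine's theorem with only one of the two points confined to the segment: the rescaled spectral
    radius may lie slightly outside, while the maximum it is compared with lies inside. *)
Lemma uniform_continuity_segment (R : realType) (f : R -> R) B e :
  continuous f -> 0 < e -> exists2 d, 0 < d &
  forall s t, `|t| <= B -> `|s - t| <= d -> `|f s - f t| <= e.
Proof.
move=> cf e0.
have cK : compact (`[-B, B]%classic : set R) by exact: segment_compact.
have H t : (`[-B, B]%classic : set R) t -> \forall t' \near t & d \near (0 : R)^'+,
    forall s, `|s - t'| <= d -> `|f s - f t'| <= e.
  move=> _; have e2 : 0 < e / 2 by rewrite divr_gt0.
  have /cvgrPdist_le /(_ _ e2) /nbhs_ballP[r /= r0 hr] := cf t.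
  have r2 : 0 < r / 2 by rewrite divr_gt0.
  exists (ball t (r / 2), [set d | d < r / 2]).
    by split; [exact: nbhsx_ballx|exact: nbhs_right_lt].
  move=> [t' d] [/= tt' dr] s st'.
  have h1 : `|f t - f t'| <= e / 2.
    by apply: hr; apply: le_ball tt'; rewrite ler_pdivrMr// ler_pMr// ler1n.
  have h2 : `|f t - f s| <= e / 2.
    apply: hr; rewrite /ball /= (le_lt_trans (ler_distD t' _ _))//.
    rewrite [ltRHS](splitr r) ltrD// distrC.
    exact: le_lt_trans dr.
  rewrite (le_trans (ler_distD (f t) _ _))// [leRHS](splitr e) distrC.
  exact: lerD.
have /compact_near_coveringP/(_ R (0 : R)^'+
  (fun d t => forall s, `|s - t| <= d -> `|f s - f t| <= e) _ H) := cK.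
move=> hd; have [d [d0 hd']] : exists d, 0 < d /\ (`[-B, B]%classic `<=`
    (fun t => forall s, `|s - t| <= d -> `|f s - f t| <= e)).
  near (0 : R)^'+ => d; exists d; split => //.
  by near: d; exact: hd.
exists d => // s t tB; apply: hd'.
by rewrite /= in_itv/= -ler_norml.
Unshelve. all: by end_near. Qed.

Section AbsApproximation.
Variable R : realType.
Implicit Types y : R.

(* The iteration that approximates [|y|] by polynomials in [y ^+ 2]. *)
Fixpoint abs_approx k y : R :=
  if k is k'.+1 then
    abs_approx k' y + (y ^+ 2 - abs_approx k' y ^+ 2) / 2
  else 0.

(** With [a = |y|] and [q] the current iterate, each step multiplies the error [a - q] by
    [1 - (a + q) / 2], which lies between 0 and [1 - a / 2] as long as [0 <= q <= a <= 1]. *)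
Lemma abs_approx_bounds k y : `|y| <= 1 ->
  0 <= `|y| - abs_approx k y <= `|y| * (1 - `|y| / 2) ^+ k
  /\ 0 <= abs_approx k y.
Proof.
move=> y1; have y0 := normr_ge0 y.
elim: k => [|k [/andP[h0 h1] h2]] /=; first by rewrite expr0 mulr1 subr0 y0 lexx.
rewrite -(real_normK (num_real y)).
set a := `|y| in y0 y1 h0 h1 *; set q := abs_approx k y in h0 h1 h2 *.
have -> : a - (q + (a ^+ 2 - q ^+ 2) / 2) = (a - q) * (1 - (a + q) / 2) by field.
split; last first.
  have : 0 <= (a - q) * (a + q) by apply: mulr_ge0 => //; lra.
  by lra.
apply/andP; split; first by apply: mulr_ge0 => //; lra.
rewrite exprSr mulrA ler_pM//; lra.
Qed.

(** The contraction factor degenerates at [y = 0], but there the error itself is small: for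
    [u = |y| / 2], the bound [(1 - u) ^+ n * (1 + n * u) <= 1] gives a rate uniform in [y]. *)
Lemma abs_approx_le k y : `|y| <= 1 ->
  `| `|y| - abs_approx k.+1 y| <= 2 / k.+1%:R.
Proof.
move=> y1; have [/andP[h0 h1] _] := abs_approx_bounds k.+1 y1.
rewrite ger0_norm// (le_trans h1)// ler_pdivlMr ?ltr0n//.
set u := `|y| / 2; have u0 : 0 <= u by rewrite divr_ge0.
have u1 : u <= 1 by have := y1; rewrite /u; lra.
have -> : `|y| = 2 * u by rewrite /u; field.
have key n : (1 - u) ^+ n * (1 + n%:R * u) <= 1.
  elim: n => [|n IH]; first by rewrite expr0 mul0r addr0 mul1r.
  apply: le_trans IH; rewrite exprSr -mulrA ler_wpM2l ?exprn_ge0 ?subr_ge0//.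
  have -> : (1 - u) * (1 + n.+1%:R * u) = 1 + n%:R * u - n.+1%:R * u ^+ 2.
    by rewrite -natr1; ring.
  by rewrite gerBl mulr_ge0 ?sqr_ge0.
have := key k.+1.
have : 0 <= (1 - u) ^+ k.+1 by rewrite exprn_ge0 ?subr_ge0.
by lra.
Qed.

End AbsApproximation.

Section UniformClosure.
Variables (R : realType) (X : Type) (A : (X -> R) -> Prop).

Definition uniform_closure (h : X -> R) : Prop :=
  forall e, 0 < e -> exists2 a, A a & forall x, `|h x - a x| <= e.

Hypothesis A_cst : forall c, A (fun=> c).
Hypothesis A_D : forall a b, A a -> A b -> A (fun x => a x + b x).
Hypothesis A_M : forall a b, A a -> A b -> A (fun x => a x * b x).
Hypothesis A_bounded : forall a, A a -> exists M, forall x, `|a x| <= M.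

Notation U := uniform_closure.

Lemma uniform_closure_id a : A a -> U a.
Proof. by move=> Aa e e0; exists a => // x; rewrite subrr normr0 ltW. Qed.

Lemma uniform_closure_cst c : U (fun=> c).
Proof. exact: uniform_closure_id. Qed.

Lemma uniform_closure_bounded h : U h -> exists M, forall x, `|h x| <= M.
Proof.
move=> /(_ _ ltr01)[a /A_bounded[M aM] ha]; exists (M + 1) => x.
by rewrite -(subrK (a x) (h x)) addrC (le_trans (ler_normD _ _))// lerD.
Qed.

Lemma uniform_closureD h g : U h -> U g -> U (fun x => h x + g x).
Proof.
move=> Uh Ug e e0; have e2 : 0 < e / 2 by rewrite divr_gt0.
have [a Aa ha] := Uh _ e2; have [b Ab hb] := Ug _ e2.
exists (fun x => a x + b x); first exact: A_D.
by move=> x; rewrite opprD addrACA (le_trans (ler_normD _ _))// [leRHS]splitr lerD.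
Qed.

Lemma uniform_closureM h g : U h -> U g -> U (fun x => h x * g x).
Proof.
move=> Uh Ug; have [M hM] := uniform_closure_bounded Uh.
have [N gN] := uniform_closure_bounded Ug.
move=> e e0; pose K := `|M| + `|N| + 1.
have K1 : 1 <= K by rewrite lerDr addr_ge0.
have K0 : 0 < K by rewrite (lt_le_trans _ K1).
(* [d <= 1] keeps the approximant [b] within [K]; the other bound makes each of the two error terms
   at most [e / 2]. *)
pose d := Num.min 1 (e / (2 * K)).
have d0 : 0 < d by rewrite lt_min ltr01 divr_gt0// mulr_gt0.
have d1 : d <= 1 by rewrite ge_min lexx.
have dK : K * d <= e / 2.
  rewrite (_ : e / 2 = K * (e / (2 * K))); last by field; rewrite gt_eqF.
  by rewrite ler_pM2l// ge_min lexx orbT.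
have [a Aa ha] := Uh _ d0; have [b Ab hb] := Ug _ d0.
exists (fun x => a x * b x); first exact: A_M.
move=> x; have -> : h x * g x - a x * b x = h x * (g x - b x) + b x * (h x - a x) by ring.
have bK : `|b x| <= K.
  rewrite -(subrK (g x) (b x)) (le_trans (ler_normD _ _))// distrC addrC.
  rewrite /K -addrA (le_trans _ (lerD (normr_ge0 M) (lexx _)))// add0r lerD//.
    by rewrite (le_trans (gN x))// ler_norm.
  exact: le_trans (hb x) d1.
have hK : `|h x| <= K.
  by rewrite (le_trans (hM x))// (le_trans (ler_norm _))// /K -addrA lerDl addr_ge0.
rewrite (le_trans (ler_normD _ _))// !normrM [leRHS]splitr lerD// (le_trans _ dK)//.
  by apply: ler_pM.
by apply: ler_pM.
Qed.

Lemma uniform_closureZ c h : U h -> U (fun x => c * h x).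
Proof. by move=> Uh; apply: uniform_closureM => //; exact: uniform_closure_cst. Qed.

Lemma uniform_closure_limit h :
  (forall e, 0 < e -> exists2 g, U g & forall x, `|h x - g x| <= e) -> U h.
Proof.
move=> hU e e0; have e2 : 0 < e / 2 by rewrite divr_gt0.
have [g Ug hg] := hU _ e2; have [a Aa ga] := Ug _ e2.
exists a => // x; rewrite (le_trans (ler_distD (g x) _ _))// [leRHS]splitr.
exact: lerD.
Qed.

Lemma uniform_closure_abs h : U h -> U (fun x => `|h x|).
Proof.
move=> Uh; have [M hM] := uniform_closure_bounded Uh.
(* Division by [K] brings the values of [h] into [[-1, 1]], where the polynomial approximation of
   the absolute value is uniform. *)
pose K := `|M| + 1; have K0 : 0 < K by rewrite ltr_wpDl.
have Uk k : U (fun x => abs_approx k (K^-1 * h x)).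
  elim: k => [|k IH] /=; first exact: uniform_closure_cst.
  apply: uniform_closureD => //.
  have -> : (fun x => ((K^-1 * h x) ^+ 2 - abs_approx k (K^-1 * h x) ^+ 2) / 2) =
    (fun x => 2^-1 * ((K^-1 * h x) * (K^-1 * h x) +
      -1 * (abs_approx k (K^-1 * h x) * abs_approx k (K^-1 * h x)))).
    by apply/funext => x; ring.
  have UK := uniform_closureZ K^-1 Uh.
  apply: uniform_closureZ; apply: uniform_closureD; first exact: uniform_closureM.
  by apply: uniform_closureZ; exact: uniform_closureM.
apply: uniform_closure_limit => e e0.
pose k := Num.truncn (2 * K / e).
exists (fun x => K * abs_approx k.+1 (K^-1 * h x)); first exact: uniform_closureZ.
move=> x; have -> : `|h x| = K * `|K^-1 * h x|.
  by rewrite normrM gtr0_norm ?invr_gt0// mulVKf// gt_eqF.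
rewrite -mulrBr normrM (gtr0_norm K0).
have y1 : `|K^-1 * h x| <= 1.
  rewrite normrM gtr0_norm ?invr_gt0// mulrC ler_pdivrMr// mul1r.
  by rewrite (le_trans (hM x))// (le_trans (ler_norm _))// lerDl.
rewrite (le_trans (ler_wpM2l (ltW K0) (abs_approx_le k y1)))//.
rewrite mulrA ler_pdivrMr ?ltr0n// -ler_pdivrMl// mulrC (mulrC K).
exact/ltW/truncnS_gt.
Qed.

Lemma uniform_closure_max h g : U h -> U g -> U (fun x => Num.max (h x) (g x)).
Proof.
move=> Uh Ug.
have -> : (fun x => Num.max (h x) (g x)) =
    (fun x => 2^-1 * ((h x + g x) + `|h x + -1 * g x|)).
  by apply/funext => x; rewrite mulN1r maxr_absE mulrC.
apply: uniform_closureZ; apply: uniform_closureD; first exact: uniform_closureD.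
by apply: uniform_closure_abs; apply: uniform_closureD => //; exact: uniform_closureZ.
Qed.

Lemma uniform_closure_min h g : U h -> U g -> U (fun x => Num.min (h x) (g x)).
Proof.
move=> Uh Ug.
have -> : (fun x => Num.min (h x) (g x)) =
    (fun x => 2^-1 * ((h x + g x) + -1 * `|h x + -1 * g x|)).
  by apply/funext => x; rewrite !mulN1r minr_absE mulrC.
apply: uniform_closureZ; apply: uniform_closureD; first exact: uniform_closureD.
apply: uniform_closureZ.
by apply: uniform_closure_abs; apply: uniform_closureD => //; exact: uniform_closureZ.
Qed.

Lemma uniform_closure_big (op : R -> R -> R) (I : Type) (r : seq I) (Q : pred I)
    (h0 : X -> R) (h : I -> X -> R) :
  (forall h g, U h -> U g -> U (fun x => op (h x) (g x))) ->
  U h0 -> (forall i, Q i -> U (h i)) ->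
  U (fun x => \big[op/h0 x]_(i <- r | Q i) h i x).
Proof.
move=> Uop Uh0 Uh; elim: r => [|i r IH].
  by under eq_fun do rewrite big_nil.
under eq_fun do rewrite big_cons.
by have [Qi|//] := boolP (Q i); apply: Uop => //; exact: Uh.
Qed.

End UniformClosure.

(** * Trigonometric polynomials as an algebra of bounded functions *)

Section TrigonometricPolynomials.
Variables (R : realType) (d : nat) (J : {set 'I_d}).

(** Products are not a constructor: convergence of expectations is linear, so induction must meet
    only sums and multiples of cosines. Closure under products follows from the product-to-sum
    formula, and the phase [b] covers sines. *)
Inductive trig_poly : (('I_d -> R) -> R) -> Prop :=
| trig_cos c b : trig_poly (fun x => cos (\sum_(j in J) c j * x j + b))
| trig_add f g : trig_poly f -> trig_poly g -> trig_poly (fun x => f x + g x)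
| trig_scale a f : trig_poly f -> trig_poly (fun x => a * f x).

Lemma trig_poly_cst a : trig_poly (fun=> a).
Proof.
have -> : (fun=> a) = (fun x : 'I_d -> R => a * cos (\sum_(j in J) 0 * x j + 0)).
  by apply/funext => x; rewrite big1 ?add0r ?cos0 ?mulr1// => j _; rewrite mul0r.
by apply: trig_scale; exact: (trig_cos (fun=> 0) 0).
Qed.

Lemma trig_polyM f g : trig_poly f -> trig_poly g -> trig_poly (fun x => f x * g x).
Proof.
elim=> [c b|f1 f2 _ IH1 _ IH2|a f1 _ IH] hg; last 2 first.
- have -> : (fun x => (f1 x + f2 x) * g x) = (fun x => f1 x * g x + f2 x * g x).
    by apply/funext => x; rewrite mulrDl.
  by apply: trig_add; [exact: IH1|exact: IH2].
- have -> : (fun x => a * f1 x * g x) = (fun x => a * (f1 x * g x)).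
    by apply/funext => x; rewrite mulrA.
  by apply: trig_scale; exact: IH.
elim: hg => [c' b'|g1 g2 _ IH1 _ IH2|a g1 _ IH]; last 2 first.
- under eq_fun do rewrite mulrDr.
  exact: trig_add.
- under eq_fun do rewrite mulrCA.
  exact: trig_scale.
have -> : (fun x : 'I_d -> R => cos (\sum_(j in J) c j * x j + b) *
      cos (\sum_(j in J) c' j * x j + b')) =
    (fun x => 2^-1 * (cos (\sum_(j in J) (c j + c' j) * x j + (b + b')) +
      cos (\sum_(j in J) (c j - c' j) * x j + (b - b')))).
  apply/funext => x.
  have -> : \sum_(j in J) (c j + c' j) * x j + (b + b') =
      (\sum_(j in J) c j * x j + b) + (\sum_(j in J) c' j * x j + b').
    by rewrite addrACA -big_split/=; congr (_ + _); apply: eq_bigr => j _; rewrite mulrDl.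
  have -> : \sum_(j in J) (c j - c' j) * x j + (b - b') =
      (\sum_(j in J) c j * x j + b) - (\sum_(j in J) c' j * x j + b').
    rewrite opprD addrACA -sumrB/=; congr (_ + _).
    by apply: eq_bigr => j _; rewrite mulrBl.
  move: (\sum_(j in J) c j * x j + b) (\sum_(j in J) c' j * x j + b') => u v.
  by rewrite cosB cosD; field.
apply: trig_scale; apply: trig_add.
  exact: (trig_cos (fun j => c j + c' j)).
exact: (trig_cos (fun j => c j - c' j)).
Qed.

Lemma trig_poly_bounded f : trig_poly f -> exists M, forall x, `|f x| <= M.
Proof.
elim=> [c b|f1 f2 _ [M1 h1] _ [M2 h2]|a f1 _ [M h]].
- by exists 1 => x; rewrite ler_norml cos_geN1 cos_le1.
- by exists (M1 + M2) => x; rewrite (le_trans (ler_normD _ _))// lerD.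
- by exists (`|a| * M) => x; rewrite normrM ler_wpM2l.
Qed.

Lemma trig_poly_sin (B : R) j : j \in J -> trig_poly (fun x => sin (x j / B)).
Proof.
move=> jJ; have -> : (fun x : 'I_d -> R => sin (x j / B)) =
  (fun x => cos (\sum_(k in J) ((k == j)%:R / B) * x k + - (pi / 2))).
  apply/funext => x; rewrite (bigD1 j)//= eqxx big1 => [|k /andP[_ /negbTE ->]].
    by rewrite addr0 mul1r (mulrC _ (x j)) cosBpihalf.
  by rewrite !mul0r.
exact: (trig_cos (fun k => (k == j)%:R / B)).
Qed.

End TrigonometricPolynomials.

Section MaxOver.
Variables (R : realType) (d : nat) (J : {set 'I_d}).
Implicit Types g : 'I_d -> R.

Lemma max_overP g : (exists j, j \in J) ->
  exists j, [/\ j \in J, max_over J g = g j & forall k, k \in J -> g k <= g j].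
Proof.
move=> [j0 j0J].
case: (@arg_maxP _ _ _ j0 (mem J) g j0J) => j jJ hj; exists j; split => //.
have Ej : [set g j | j in [set j | j \in J]] (g j) by exists j.
have ubj : ubound [set g j | j in [set j | j \in J]] (g j).
  by move=> _ [k kJ <-]; exact: hj.
apply/le_anti/andP; split; first by apply: sup_le_ub => //; exists (g j).
by apply: ub_le_sup => //; exists (g j).
Qed.

Lemma max_over_eq g j : j \in J -> (forall k, k \in J -> g k <= g j) ->
  max_over J g = g j.
Proof.
move=> jJ hj; have [k [kJ -> hk]] := max_overP g (ex_intro _ j jJ).
by apply/le_anti; rewrite hj// hk.
Qed.

(** The default is a member of the family, so that negative values are handled too. *)
Lemma max_overE g j0 : j0 \in J -> max_over J g = \big[Num.max/g j0]_(j in J) g j.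
Proof.
move=> j0J; have [j [jJ -> hj]] := max_overP g (ex_intro _ j0 j0J).
apply/le_anti/andP; split; first exact: le_bigmax_cond.
by apply: bigmax_le => //; exact: hj.
Qed.

Lemma max_over_homo g (f : R -> R) : (exists j, j \in J) ->
  (forall j k, j \in J -> k \in J -> g j <= g k -> f (g j) <= f (g k)) ->
  max_over J (fun j => f (g j)) = f (max_over J g).
Proof.
move=> J0 hf; have [j [jJ -> hj]] := max_overP g J0.
by apply: max_over_eq => // k kJ; apply: hf => //; exact: hj.
Qed.

End MaxOver.

(** * Approximation of a function of the maximum on a box *)

Section Approximation.
Variables (R : realType) (d : nat) (J : {set 'I_d}).
Hypothesis J0 : exists j, j \in J.

Let U := uniform_closure (@trig_poly R d J).

Let Ucst c : U (fun=> c).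
Proof. by apply: uniform_closure_cst; exact: trig_poly_cst. Qed.

Let Umax h g : U h -> U g -> U (fun x => Num.max (h x) (g x)).
Proof.
apply: uniform_closure_max;
  [exact: trig_poly_cst|exact: trig_add|exact: trig_polyM|exact: trig_poly_bounded].
Qed.

Let Umin h g : U h -> U g -> U (fun x => Num.min (h x) (g x)).
Proof.
apply: uniform_closure_min;
  [exact: trig_poly_cst|exact: trig_add|exact: trig_polyM|exact: trig_poly_bounded].
Qed.

Let UD h g : U h -> U g -> U (fun x => h x + g x).
Proof. by apply: uniform_closureD; exact: trig_add. Qed.

Let UZ c h : U h -> U (fun x => c * h x).
Proof.
apply: uniform_closureZ; [exact: trig_poly_cst|exact: trig_polyM|exact: trig_poly_bounded].
Qed.

Let Uabs h : U h -> U (fun x => `|h x|).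
Proof.
apply: uniform_closure_abs;
  [exact: trig_poly_cst|exact: trig_add|exact: trig_polyM|exact: trig_poly_bounded].
Qed.

Lemma uniform_closure_max_sin B :
  U (fun x => max_over J (fun j => sin (x j / B))).
Proof.
have [j0 j0J] := J0.
under eq_fun do rewrite (max_overE _ j0J).
apply: uniform_closure_big => //.
  by apply: uniform_closure_id; exact: trig_poly_sin.
by move=> j jJ; apply: uniform_closure_id; exact: trig_poly_sin.
Qed.

(* On the box, f (max x) is the infimum over s of f s + K |max x - s| up to e;
   the distance |t - s| is replaced by the equivalent |sin (t / B) - sin (s / B)|
   and s runs over a finite grid. *)
Lemma trig_approximation_of_max (f : R -> R) M B e : continuous f ->
  (forall t, `|f t| <= M) -> 0 < B -> 0 < e ->
  exists h : ('I_d -> R) -> R, [/\ U h, forall x, `|h x| <= M &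
    forall x, (forall j, j \in J -> `|x j| <= B) -> `|f (max_over J x) - h x| <= e].
Proof.
move=> cf fM B0 e0.
have e2 : 0 < e / 2 by rewrite divr_gt0.
have M0 : 0 <= M := le_trans (normr_ge0 _) (fM 0).
have [de de0 hde] := uniform_continuity_segment B cf e2.
have c0 : 0 < cos 1 :> R by exact: cos1_gt0.
(* Chosen so that the penalty reaches [2 * M], the maximal oscillation of [f], as soon as [|s - t|]
   exceeds the continuity modulus [de]. *)
pose K := 2 * M * B / (cos 1 * de).
have K0 : 0 <= K by rewrite !mulr_ge0 ?invr_ge0 ?mulr_ge0// ltW.
(* Mesh of the grid: within [eta], both the variation of [f] and the penalty are at most [e / 2].
   The denominator [K + 1] is positive even if [K = 0]. *)
pose eta := Num.min de (e / 2 * B / (K + 1)).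
have K1 : 0 < K + 1 by rewrite ltr_wpDl.
have eta0 : 0 < eta by rewrite lt_min de0 !divr_gt0// mulr_gt0.
have eta_de : eta <= de by rewrite ge_min lexx.
have eta_K : K * (eta / B) <= e / 2.
  have : eta <= e / 2 * B / (K + 1) by rewrite ge_min lexx orbT.
  rewrite ler_pdivlMr// mulrDr mulr1 => h.
  rewrite mulrA ler_pdivrMr// mulrC; apply: le_trans h.
  by rewrite lerDl ltW.
pose N := Num.truncn (2 * B / eta).
(* The cap at [B] keeps every grid point inside the box. *)
pose s (k : nat) := Num.min B (- B + k%:R * eta).
have sB k : `|s k| <= B.
  rewrite ler_norml /s ge_min lexx/= andbT le_min; apply/andP; split.
    by rewrite (le_trans _ (ltW B0))// oppr_le0 ltW.
  by rewrite lerDl mulr_ge0// ltW.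
pose u (x : 'I_d -> R) := max_over J (fun j => sin (x j / B)).
(* The default [M] bounds [h] above on the whole space; [f >= - M] and the nonnegative penalty bound
   it below. *)
pose h x : R := \big[Num.min/M]_(k < N.+2) (f (s k) + K * `|u x + -1 * sin (s k / B)|).
exists h; rewrite /h; split.
- apply: uniform_closure_big; [exact: Umin|exact: Ucst|move=> k _].
  exact: (UD (Ucst (f (s k))) (UZ K (Uabs (UD (uniform_closure_max_sin B)
    (UZ (-1) (Ucst (sin (s k / B)))))))).
- move=> x; rewrite ler_norml bigmin_le_id andbT le_bigmin//.
    by rewrite (le_trans _ M0)// oppr_le0.
  move=> k _; rewrite -[leLHS]addr0; apply: lerD; last exact: mulr_ge0.
  by have := fM (s k); rewrite ler_norml => /andP[].
move=> x xB; set t := max_over J x.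
have tB : `|t| <= B by have [j [jJ hj _]] := max_overP x J0; rewrite /t hj xB.
have divB y : `|y| <= B -> `|y / B| <= 1.
  by move=> yB; rewrite normrM normfV (gtr0_norm B0) ler_pdivrMr// mul1r.
have ut : u x = sin (t / B).
  rewrite /u (max_over_homo (f := fun y => sin (y / B)))// => j k jJ kJ jk.
  have pi1 : 1 <= pi / 2 :> R by exact: pihalf_ge1.
  have := divB _ (xB _ jJ); have := divB _ (xB _ kJ).
  rewrite !ler_norml => /andP[k1 k2] /andP[j1 j2].
  rewrite leNgt ltr_sin ?in_itv/=; last 2 first.
  - by apply/andP; split; lra.
  - by apply/andP; split; lra.
  by rewrite -leNgt ler_pM2r ?invr_gt0.
rewrite ler_norml; apply/andP; split.
  (* The grid point just below [t] shows that [h x] exceeds [f t] by at most [e]. *)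
  pose k0 := Num.truncn ((t + B) / eta).
  have tB0 : 0 <= (t + B) / eta.
    by move: tB; rewrite ler_norml => /andP[? _]; apply: divr_ge0; [lra|exact: ltW].
  have /andP[k1 k2] := truncn_itv tB0.
  have k0N : (k0 < N.+2)%N.
    rewrite ltnS leqW// le_truncn// ler_pM2r ?invr_gt0//.
    by move: tB; rewrite ler_norml => /andP[_ ?]; rewrite mulr2n mulrDl mul1r lerD2r.
  have st : 0 <= t - s k0 <= eta.
    move: k1 k2; rewrite -/k0 ler_pdivlMr// ltr_pdivrMr// -natr1 mulrDl mul1r => k1 k2.
    have -> : s k0 = - B + k0%:R * eta.
      apply/min_idPr; move: tB; rewrite ler_norml => /andP[_ ?]; lra.
    by apply/andP; split; lra.
  have := bigmin_le_cond M (fun k : 'I_N.+2 => f (s k) + K * `|u x + -1 * sin (s k / B)|)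
    (isT : xpredT (Ordinal k0N)).
  move: (\big[_/_]_(_ < _) _) => z /= hz.
  have h1 : `|f (s k0) - f t| <= e / 2.
    apply: hde => //; move: st => /andP[? ?]; rewrite distrC ger0_norm//.
    exact: le_trans eta_de.
  have h2 : K * `|u x + -1 * sin (s k0 / B)| <= e / 2.
    rewrite (le_trans _ eta_K)// ler_wpM2l// mulN1r ut (le_trans (sin_lipschitz _ _))//.
    rewrite -mulrBl normrM normfV (gtr0_norm B0) ler_pM2r ?invr_gt0//.
    by move: st => /andP[? ?]; rewrite ger0_norm.
  by move: h1; rewrite ler_norml => /andP[_ ?]; lra.
rewrite lerBlDr addrC -lerBlDr.
apply: le_bigmin => [|k _].
  by have := fM t; rewrite ler_norml => /andP[_ ?]; lra.
(* For the lower bound, grid points near [t] are handled by uniform continuity and distant ones by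
   the penalty. *)
have [std|std] := leP `|s k - t| de.
  have := hde _ _ tB std; rewrite ler_norml => /andP[? _].
  have := mulr_ge0 K0 (normr_ge0 (u x + -1 * sin (s k / B))); lra.
have h2 : 2 * M <= K * `|u x + -1 * sin (s k / B)|.
  have h3 := sin_expanding (divB _ tB) (divB _ (sB k)).
  apply: le_trans (ler_wpM2l K0 _); last by rewrite mulN1r ut; exact: h3.
  rewrite -mulrBl normrM normfV (gtr0_norm B0) distrC /K.
  have -> : 2 * M * B / (cos 1 * de) * (cos 1 * (`|s k - t| / B)) =
      2 * M * (`|s k - t| / de) by field; rewrite !gt_eqF.
  by rewrite ler_peMr ?mulr_ge0// ler_pdivlMr// mul1r ltW.
have := fM t; have := fM (s k).
by rewrite !ler_norml => /andP[? _] /andP[_ ?]; lra.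
Qed.

End Approximation.

(** * Gaussian integrals *)

(** The fundamental theorem on [[-n, n]], with dominated convergence by [|f|] to reach the whole
    line. *)
Lemma Rintegral_derivT (R : realType) (F f : R -> R) :
  (forall x : R, is_derive x 1 F (f x)) -> continuous f ->
  lebesgue_measure.-integrable [set: R] (EFin \o f) ->
  F n%:R @[n --> \oo] --> (0 : R) -> F (- n%:R) @[n --> \oo] --> (0 : R) ->
  \int[lebesgue_measure]_x f x = 0.
Proof.
move=> dF cf intf Fp Fm; set mu := lebesgue_measure.
pose I (n : nat) : set R := `[- n%:R, n%:R]%classic.
have mf : measurable_fun setT f by exact: continuous_measurable_fun.
have FTC n : (0 < n)%N -> (\int[mu]_(x in I n) (f x)%:E = (F n%:R - F (- n%:R))%:E)%E.
  move=> n0; rewrite EFinB; apply: continuous_FTC2.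
  - by rewrite (@lt_trans _ _ 0)// ?oppr_lt0 ltr0n.
  - exact: continuous_subspaceT.
  - have cF x : {for x, continuous F}.
      by apply/differentiable_continuous/derivable1_diffP; case: (dF x).
    split; first by move=> x _; case: (dF x).
    + exact/cvg_at_right_filter/cF.
    + exact/cvg_at_left_filter/cF.
  - by move=> x _; rewrite derive1E; apply: derive_val.
have cvgI : (\int[mu]_x ((f \_ (I n)) x)%:E @[n --> \oo] --> \int[mu]_x (f x)%:E)%E.
  apply: (@dominated_cvg _ _ _ mu setT measurableT _ _ (fun x => (`|f x|)%:E)) => //.
  - move=> n; apply/measurable_EFinP.
    have mI : measurable (I n) by exact: measurable_itv.
    by apply/(measurable_restrictT _ mI); exact: measurable_funTS.
  - move=> x _; apply: cvg_EFin; first exact: nearW.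
    apply: cvg_near_cst.
    near=> n; rewrite /= patchE mem_set// /I /= in_itv/= -ler_norml.
    by near: n; exact: nbhs_infty_ger.
  - exact: (integrable_norm intf).
  - move=> n x _; rewrite lee_fin patchE; case: ifP => // _.
    by rewrite normr0.
have cvg0 : (\int[mu]_x ((f \_ (I n)) x)%:E @[n --> \oo] --> 0%:E)%E.
  have : (F n%:R - F (- n%:R)) @[n --> \oo] --> (0 - 0 : R) by exact: cvgB.
  rewrite subr0 => H.
  have : (F n%:R - F (- n%:R))%:E @[n --> \oo] --> 0%:E.
    by apply: cvg_EFin => //; exact: nearW.
  apply: cvg_trans; apply: near_eq_cvg; near=> n.
  rewrite -FTC; last by near: n; exact: nbhs_infty_gt.
  by rewrite [LHS]integral_mkcond; apply: eq_integral => x _; rewrite restrict_EFin.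
have := cvg_unique _ cvgI cvg0.
by rewrite /Rintegral => ->.
Unshelve. all: by end_near. Qed.

Section GaussianIntegrals.
Variables (R : realType) (m s : R).
Hypothesis s0 : s != 0.
Notation mu := lebesgue_measure.
Notation phi := (normal_pdf m s).

(** This is [2 cosh (k y)]. It dominates constants and linear terms, yet remains integrable against
    a normal density, because an exponential tilt merely shifts the mean and rescales. *)
Definition exp_weight (k y : R) : R := expR (k * y) + expR (- (k * y)).

Lemma normal_pdf_tilt a x :
  expR (a * (x - m)) * phi x =
  expR (a ^+ 2 * s ^+ 2 / 2) * normal_pdf (m + a * s ^+ 2) s x.
Proof.
rewrite /normal_pdf (negbTE s0) /normal_fun mulrCA [RHS]mulrCA -!expRD.
by congr (_ * expR _); field.
Qed.

Lemma exp_weight_ge k y : `|k * y| <= exp_weight k y.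
Proof.
rewrite /exp_weight; have h1 := expR_ge1Dx (k * y).
have h2 := expR_ge1Dx (- (k * y)).
have h3 := expR_ge0 (k * y); have h4 := expR_ge0 (- (k * y)).
by rewrite ler_norml; apply/andP; split; lra.
Qed.

Lemma exp_weight_ge1 k y : 1 <= exp_weight k y.
Proof.
rewrite /exp_weight; have h1 := expR_ge1Dx (k * y).
have h2 := expR_ge1Dx (- (k * y)).
by have h3 := expR_ge0 (k * y); have h4 := expR_ge0 (- (k * y)); lra.
Qed.

Lemma exp_weight_ge0 k y : 0 <= exp_weight k y.
Proof. exact: le_trans (exp_weight_ge1 k y). Qed.

Lemma exp_weightM y : exp_weight 1 y * exp_weight 1 y <= 2 * exp_weight 2 y.
Proof.
have -> : exp_weight 2 y = expR (y + y) + expR (- y - y).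
  by rewrite /exp_weight; congr (expR _ + expR _); ring.
rewrite /exp_weight mul1r !expRD.
set p := expR y; set q := expR (- y).
have pq : p * q = 1 by rewrite -expRD subrr expR0.
have : 0 <= (p - q) ^+ 2 by exact: sqr_ge0.
by lra.
Qed.

Lemma exp_weight_pdf k x : exp_weight k (x - m) * phi x =
  expR (k ^+ 2 * s ^+ 2 / 2) * (normal_pdf (m + k * s ^+ 2) s x +
                                normal_pdf (m - k * s ^+ 2) s x).
Proof.
have e1 := normal_pdf_tilt k x; have e2 := normal_pdf_tilt (- k) x.
by rewrite /exp_weight mulrDl e1 -[- (k * _)]mulNr e2 sqrrN [RHS]mulrDr mulNr.
Qed.

Lemma exp_weight_pdf_le k x : exp_weight k (x - m) * phi x <=
  expR (k ^+ 2 * s ^+ 2 / 2) * (normal_peak s + normal_peak s).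
Proof. by rewrite exp_weight_pdf ler_wpM2l ?expR_ge0// lerD// normal_pdf_ub. Qed.

Lemma integrable_gaussian_dominated (g : R -> R) C k : measurable_fun setT g ->
  (forall x, `|g x| <= C * exp_weight k (x - m)) ->
  mu.-integrable setT (EFin \o (fun x => g x * phi x)).
Proof.
move=> mg hg.
have iW : mu.-integrable setT (EFin \o (fun x => C * (exp_weight k (x - m) * phi x))).
  have i1 := integrableD measurableT (integrable_normal_pdf (m + k * s ^+ 2) s)
    (integrable_normal_pdf (m - k * s ^+ 2) s).
  have i2 := integrableZl measurableT C
    (integrableZl measurableT (expR (k ^+ 2 * s ^+ 2 / 2)) i1).
  apply: eq_integrable i2 => // x _ /=.
  by rewrite exp_weight_pdf.
apply: le_integrable iW => //.
  apply/measurable_EFinP; apply: measurable_funM => //; exact: measurable_normal_pdf.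
move=> x _; rewrite lee_fin.
have pdf0 := normal_pdf_ge0 m s x.
rewrite normrM (ger0_norm pdf0) mulrA.
rewrite (le_trans _ (ler_norm _))// ler_wpM2r//.
Qed.

Lemma is_derive_normal_pdf (x : R) :
  is_derive x 1 phi (- (s ^+ 2)^-1 * (x - m) * phi x).
Proof.
have -> : phi = (fun x => normal_peak s * expR (- (x - m) ^+ 2 / (s ^+ 2 *+ 2))).
  by rewrite /normal_pdf (negbTE s0).
pose u (x : R) : R := - (x - m) ^+ 2 / (s ^+ 2 *+ 2).
have du : is_derive x 1 u (- (s ^+ 2)^-1 * (x - m)).
  rewrite /u; apply: is_derive_eq.
  by rewrite /GRing.scale/=; field.
have -> : (fun x => normal_peak s * expR (- (x - m) ^+ 2 / (s ^+ 2 *+ 2))) =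
  (normal_peak s *: (expR \o u)) by [].
apply: is_derive_eq.
by rewrite /GRing.scale/= /u; ring.
Qed.

(* Stein's identity: the derivative of [g * phi] integrates to 0 over the line. *)
Lemma gaussian_stein (g g' : R -> R) C :
  (forall x : R, is_derive x 1 g (g' x)) -> continuous g -> continuous g' ->
  (forall x, `|g x| <= C * exp_weight 1 (x - m)) ->
  (forall x, `|g' x| <= C * exp_weight 1 (x - m)) ->
  \int[mu]_x ((x - m) * g x * phi x) = s ^+ 2 * \int[mu]_x (g' x * phi x).
Proof.
move=> dg cg cg' hg hg'.
have s2 : s ^+ 2 != 0 by rewrite expf_neq0.
have C0 : 0 <= C.
  have := le_trans (normr_ge0 _) (hg m).
  by rewrite pmulr_lge0// (lt_le_trans ltr01)// exp_weight_ge1.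
have xg_le x : `|(x - m) * g x| <= 2 * C * exp_weight 2 (x - m).
  rewrite normrM; have := exp_weight_ge 1 (x - m); rewrite mul1r => h.
  rewrite (le_trans (ler_pM _ _ h (hg x)))//.
  rewrite mulrCA -[leRHS]mulrA [leRHS]mulrCA.
  exact: (ler_wpM2l C0 (exp_weightM _)).
have ig' : mu.-integrable setT (EFin \o (fun x => g' x * phi x)).
  by apply: integrable_gaussian_dominated hg'; exact: continuous_measurable_fun.
have ig : mu.-integrable setT (EFin \o (fun x => (x - m) * g x * phi x)).
  apply: (@integrable_gaussian_dominated _ (2 * C) 2).
    apply: measurable_funM; first exact: measurable_funB.
    exact: continuous_measurable_fun.
  exact: xg_le.
pose f x := g' x * phi x - (s ^+ 2)^-1 * ((x - m) * g x * phi x).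
have cphi : continuous phi by exact: continuous_normal_pdf.
(* Decay of [g * phi] at rate [1 / |x - m|], enough for the boundary terms to vanish. *)
have [D D0 hD] : exists2 D, 0 < D & forall x, `|x - m| * `|g x * phi x| <= D.
  pose D := 2 * C * (expR (2 ^+ 2 * s ^+ 2 / 2) * (normal_peak s + normal_peak s)).
  have D0 : 0 <= D.
    by rewrite !mulr_ge0 ?expR_ge0// addr_ge0// normal_peak_ge0.
  exists (D + 1); first by rewrite ltr_wpDl.
  move=> x; rewrite -normrM mulrA normrM.
  rewrite (ger0_norm (normal_pdf_ge0 m s x)).
  rewrite (le_trans (ler_wpM2r (normal_pdf_ge0 m s x) (xg_le x)))//.
  apply: (@le_trans _ _ D); last by rewrite lerDl.
  rewrite -[leLHS](mulrA (2 * C)) /D; apply: ler_wpM2l; first exact: mulr_ge0.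
  exact: exp_weight_pdf_le.
have vanish (a : nat -> R) : (forall n, `|a n| = n%:R) ->
    (g (a n) * phi (a n)) @[n --> \oo] --> (0 : R).
  move=> ha; apply/cvgrPdist_le => e e0.
  apply: filterS (nbhs_infty_ger (`|m| + D / e)) => n hn.
  rewrite sub0r normrN.
  have h : D / e <= `|a n - m|.
    have := lerB_dist (a n) m; rewrite ha; lra.
  have De : 0 < D / e by rewrite divr_gt0.
  rewrite -(ler_pM2l De) divfK ?gt_eqF// (le_trans _ (hD (a n)))//.
  exact: ler_wpM2r.
have : \int[mu]_x f x = 0.
  apply: (@Rintegral_derivT _ (fun x => g x * phi x)).
  - move=> x; apply: is_derive_eq.
      exact: (is_deriveM (dg x) (is_derive_normal_pdf x)).
    by rewrite /f /GRing.scale/=; field.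
  - move=> x; apply: cvgB; first by apply: cvgM; [exact: cg'|exact: cphi].
    apply: cvgM; first exact: cvg_cst.
    apply: cvgM; last exact: cphi.
    apply: cvgM; last exact: cg.
    by apply: cvgB; [exact: cvg_id|exact: cvg_cst].
  - exact: (integrableB measurableT ig' (integrableZl measurableT (s ^+ 2)^-1 ig)).
  - apply: (vanish (fun n => n%:R)) => n; exact: ger0_norm.
  - apply: (vanish (fun n => - n%:R)) => n; rewrite normrN; exact: ger0_norm.
rewrite /f RintegralB//; last exact: (integrableZl measurableT (s ^+ 2)^-1 ig).
rewrite RintegralZl// => /eqP; rewrite subr_eq0 => /eqP ->.
by rewrite mulrA mulfV// mul1r.
Qed.

End GaussianIntegrals.

(** * Moments and characteristic function of a normal density *)

Section GaussianCharfun.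
Variables (R : realType) (m s : R).
Hypothesis s0 : s != 0.
Notation mu := lebesgue_measure.
Notation phi := (normal_pdf m s).

Lemma Rintegral_normal_pdf : \int[mu]_x phi x = 1.
Proof. by rewrite /Rintegral integral_normal_pdf. Qed.

Let dist_le (x : R) : `|x - m| <= 1 * exp_weight 1 (x - m).
Proof. by rewrite mul1r; have := exp_weight_ge 1 (x - m); rewrite mul1r. Qed.

Let cst_le (c x : R) : `|c| <= `|c| * exp_weight 1 (x - m).
Proof. by rewrite ler_peMr// exp_weight_ge1. Qed.

Let is_derive_center (x : R) : is_derive x 1 (fun x : R => x - m) 1.
Proof. by apply: is_derive_eq; rewrite subr0. Qed.

Let continuous_center : continuous (fun x : R => x - m).
Proof. by move=> x; apply: cvgB; [exact: cvg_id|exact: cvg_cst]. Qed.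

Lemma gaussian_mean : \int[mu]_x ((x - m) * phi x) = 0.
Proof.
have := @gaussian_stein R m s s0 (fun=> 1) (fun=> 0) 1 (fun x => is_derive_cst _ _ _).
move=> /(_ (fun x => cvg_cst _) (fun x => cvg_cst _)) H.
under eq_Rintegral => x _ do rewrite -[x - m]mulr1.
rewrite H; last 2 first.
- by move=> x; have := cst_le 1 x; rewrite normr1.
- by move=> x; rewrite normr0 mul1r exp_weight_ge0.
under eq_Rintegral do rewrite mul0r.
by rewrite /Rintegral integral0 mulr0.
Qed.

Lemma gaussian_variance : \int[mu]_x ((x - m) ^+ 2 * phi x) = s ^+ 2.
Proof.
have H := @gaussian_stein R m s s0 (fun x => x - m) (fun=> 1) 1 is_derive_center
  continuous_center (fun x => cvg_cst _) dist_le.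
under eq_Rintegral => x _ do rewrite expr2.
rewrite H; last by move=> x; have := cst_le 1 x; rewrite normr1.
under eq_Rintegral do rewrite mul1r.
by rewrite Rintegral_normal_pdf mulr1.
Qed.

Let u (b t : R) := \int[mu]_x (cos (t * (x - m) + b) * phi x).

Let continuous_arg (b t : R) : continuous (fun x : R => t * (x - m) + b).
Proof.
move=> x; apply: cvgD; last exact: cvg_cst.
by apply: cvgM; [exact: cvg_cst|exact: continuous_center].
Qed.

(** Differentiation under the integral produces [(x - m) * sin], and Stein's identity for the sine
    turns it back into [t * cos]. *)
Lemma is_derive_gaussian_charfun (b t : R) : is_derive t 1 (u b) (- (s ^+ 2 * t * u b t)).
Proof.
pose f (t x : R) := cos (t * (x - m) + b) * phi x.
have mcos (t' : R) : measurable_fun setT (fun x : R => cos (t' * (x - m) + b)).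
  apply: continuous_measurable_fun => x.
  by apply: continuous_comp; [exact: continuous_arg|exact: continuous_cos].
have intf t' : mu.-integrable setT (EFin \o f t').
  apply: (@integrable_gaussian_dominated _ _ _ s0 _ 1 1); first exact: mcos.
  move=> x; rewrite mul1r (le_trans _ (exp_weight_ge1 _ _))//.
  by rewrite ler_norml cos_geN1 cos_le1.
have df (t' x : R) : is_derive t' 1 (f ^~ x) (- sin (t' * (x - m) + b) * (x - m) * phi x).
  rewrite /f; apply: is_derive_eq.
  by rewrite /GRing.scale/=; ring.
have dfE (t' x : R) : partial1of2 f t' x = - sin (t' * (x - m) + b) * (x - m) * phi x.
  by rewrite partial1of2E; exact: derive_val.
(* Any neighbourhood of [t] would do: the dominating function [G] does not depend on the
   parameter. *)
have It : (`]t - 1, t + 1[%classic : set R) t.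
  by rewrite /= in_itv/=; apply/andP; split; lra.
have derf1 (t' x : R) : (`]t - 1, t + 1[%classic : set R) t' -> setT x ->
    derivable (f ^~ x) t' 1.
  by move=> _ _; case: (df t' x).
pose G x := `|x - m| * phi x.
have G0 x : 0 <= G x by rewrite mulr_ge0// normal_pdf_ge0.
have iG : mu.-integrable setT (EFin \o G).
  apply: (@integrable_gaussian_dominated _ _ _ s0 _ 1 1).
    by apply: measurableT_comp => //; exact: measurable_funB.
  by move=> x; rewrite normr_id.
have Gub (t' x : R) : (`]t - 1, t + 1[%classic : set R) t' -> setT x ->
    `|partial1of2 f t' x| <= G x.
  move=> _ _; rewrite dfE normrM (ger0_norm (normal_pdf_ge0 _ _ _)).
  apply: ler_wpM2r; first exact: normal_pdf_ge0.
  by rewrite normrM normrN ler_piMl// ler_norml sin_geN1 sin_le1.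
have D1 := @derivable_under_integral R _ _ mu f setT measurableT t _ _ It
  (fun t' _ => intf t') derf1 G G0 iG Gub.
have D2 := @differentiation_under_integral R _ _ mu f setT measurableT t _ _ It
  (fun t' _ => intf t') derf1 G G0 iG Gub.
apply: DeriveDef; first exact: D1.
rewrite -derive1E D2.
have -> : \int[mu]_x partial1of2 f t x =
    - \int[mu]_x ((x - m) * sin (t * (x - m) + b) * phi x).
  rewrite -mulN1r -RintegralZl//.
    by apply: eq_Rintegral => x _; rewrite dfE; ring.
  apply: (@integrable_gaussian_dominated _ _ _ s0 _ 1 1).
    apply: measurable_funM; first exact: measurable_funB.
    apply: continuous_measurable_fun => x.
    by apply: continuous_comp; [exact: continuous_arg|exact: continuous_sin].
  move=> x; rewrite (le_trans _ (dist_le x))// normrM ler_piMr//.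
  by rewrite ler_norml sin_geN1 sin_le1.
have -> : \int[mu]_x ((x - m) * sin (t * (x - m) + b) * phi x) =
    s ^+ 2 * \int[mu]_x (t * cos (t * (x - m) + b) * phi x).
  apply: (@gaussian_stein R m s s0 (fun x => sin (t * (x - m) + b))
    (fun x => t * cos (t * (x - m) + b)) (1 + `|t|)).
  - move=> x; apply: is_derive_eq.
    by rewrite /GRing.scale/=; ring.
  - by move=> x; apply: continuous_comp; [exact: continuous_arg|exact: continuous_sin].
  - move=> x; apply: cvgM; first exact: cvg_cst.
    by apply: continuous_comp; [exact: continuous_arg|exact: continuous_cos].
  - move=> x; rewrite (@le_trans _ _ 1)//.
      by rewrite ler_norml sin_geN1 sin_le1.
    by rewrite -[leLHS]mulr1 ler_pM// ?exp_weight_ge1// lerDl.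
  - move=> x; rewrite normrM ler_pM//.
      by rewrite lerDr.
    rewrite (le_trans _ (exp_weight_ge1 _ _))//.
    by rewrite ler_norml cos_geN1 cos_le1.
rewrite -mulrA; congr (- (_ * _)).
rewrite -(RintegralZl t measurableT (intf t)).
by apply: eq_Rintegral => x _; rewrite mulrA.
Qed.

(** Multiplied by the integrating factor [expR (s ^+ 2 * t ^+ 2 / 2)], the solution of the
    differential equation is constant in [t]. *)
Lemma gaussian_charfun t b :
  \int[mu]_x (cos (t * (x - m) + b) * phi x) = expR (- (s ^+ 2 * t ^+ 2 / 2)) * cos b.
Proof.
pose v (r : R) := u b r * expR (s ^+ 2 * r ^+ 2 / 2).
have dv (r : R) : is_derive r 1 v 0.
  have du := is_derive_gaussian_charfun b r.
  have de : is_derive r 1 (fun r : R => s ^+ 2 * r ^+ 2 / 2) (s ^+ 2 * r).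
    by apply: is_derive_eq; rewrite /GRing.scale/=; field.
  rewrite /v; apply: is_derive_eq.
  by rewrite /GRing.scale/=; ring.
have := is_derive_0_is_cst t 0 dv.
rewrite /v (expr0n _ 2) /= mulr0 mul0r expR0 mulr1.
have -> : u b 0 = cos b.
  rewrite /u; under eq_Rintegral do rewrite mul0r add0r.
  rewrite RintegralZl// ?Rintegral_normal_pdf ?mulr1//.
  exact: integrable_normal_pdf.
change (u b t * expR (s ^+ 2 * t ^+ 2 / 2) = cos b ->
  u b t = expR (- (s ^+ 2 * t ^+ 2 / 2)) * cos b).
by move=> <-; rewrite [RHS]mulrC -[RHS]mulrA -expRD subrr expR0 mulr1.
Qed.

End GaussianCharfun.

(** * Expectations computed from the law of a variable *)

Section NormalLaw.
Context (R : realType) (dT : measure_display) (Omega : measurableType dT).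
Variables (P : probability Omega R) (X : Omega -> R) (m s : R).
Notation mu := lebesgue_measure.
Hypothesis mX : measurable_fun setT X.

(** Change of variables with the Radon-Nikodym derivative, which agrees almost everywhere with
    [normal_pdf] because both have the same integrals over measurable sets. *)
Lemma ge0_integral_normal_prob (h : R -> \bar R) : measurable_fun setT h ->
  (forall x, (0 <= h x)%E) ->
  (\int[normal_prob m s]_x h x = \int[mu]_x (h x * (normal_pdf m s x)%:E))%E.
Proof.
move=> mh h0.
have dom := normal_prob_dominates m s.
rewrite -(Radon_Nikodym_SigmaFinite.change_of_variables dom h0 measurableT mh).
have irn := Radon_Nikodym_SigmaFinite.f_integrable dom.
apply: ae_eq_integral => //.
- by apply: emeasurable_funM => //; exact: (measurable_int _ irn).
- apply: emeasurable_funM => //; apply/measurable_EFinP.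
  exact: measurable_normal_pdf.
- have : ae_eq mu setT (Radon_Nikodym_SigmaFinite.f (normal_prob m s) mu)
      (fun x => (normal_pdf m s x)%:E).
    apply: integral_ae_eq => //.
      by apply/measurable_EFinP; exact: measurable_normal_pdf.
    move=> E _ mE.
    by rewrite -Radon_Nikodym_SigmaFinite.f_integral.
  by apply: filterS => x hx xT; rewrite hx.
Qed.

Hypothesis lawX : forall A : set (measurableTypeR R), measurable A ->
  P (X @^-1` A) = normal_prob m s A.

Lemma ge0_integral_normal_law (h : R -> R) : measurable_fun setT h ->
  (forall x, 0 <= h x) ->
  (\int[P]_w (h (X w))%:E = \int[mu]_x (h x * normal_pdf m s x)%:E)%E.
Proof.
move=> mh h0.
have mh' : measurable_fun setT (EFin \o h) by exact/measurable_EFinP.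
have mX' : @measurable_fun _ _ Omega (measurableTypeR R) setT X by exact: mX.
pose X' : {RV P >-> measurableTypeR R} :=
  @MeasurableFun.Pack _ _ _ (measurableTypeR R) X (MeasurableFun.Class
      (isMeasurableFun.Build _ _ _ (measurableTypeR R) X mX')).
transitivity (\int[distribution P X']_x (EFin \o h) x)%E.
  by rewrite ge0_integral_distribution.
transitivity (\int[normal_prob m s]_x (EFin \o h) x)%E.
  by apply: eq_measure_integral => A mA _; exact: lawX.
by rewrite ge0_integral_normal_prob// => x; rewrite lee_fin.
Qed.

Lemma integral_normal_law (h : R -> R) : measurable_fun setT h ->
  mu.-integrable setT (EFin \o (fun x => h x * normal_pdf m s x)) ->
  P.-integrable setT (EFin \o (h \o X)) /\
  \int[P]_w h (X w) = \int[mu]_x (h x * normal_pdf m s x).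
Proof.
move=> mh ih.
have ge0_int (g : R -> R) : measurable_fun setT g -> (forall x, 0 <= g x) ->
    mu.-integrable setT (EFin \o (fun x => g x * normal_pdf m s x)) ->
    P.-integrable setT (EFin \o (g \o X)).
  move=> mg g0 ig; apply/integrableP; split.
    by apply/measurable_EFinP; exact: measurableT_comp.
  under eq_integral do rewrite /= ger0_norm//.
  rewrite ge0_integral_normal_law//.
  have /integrableP[_] := ig.
  under eq_integral do rewrite /= ger0_norm ?mulr_ge0 ?normal_pdf_ge0//.
  by [].
(* A signed [h] is the difference of the nonnegative functions [|h| + h] and [|h|]. *)
have mah : measurable_fun setT (fun x => `|h x|) by exact: measurableT_comp.
have iah : mu.-integrable setT (EFin \o (fun x => `|h x| * normal_pdf m s x)).
  have := integrable_norm ih; apply: eq_integrable => // x _ /=.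
  by rewrite normrM (ger0_norm (normal_pdf_ge0 _ _ _)).
have iPa := ge0_int _ mah (fun x => normr_ge0 _) iah.
have mp : measurable_fun setT (fun x => `|h x| + h x) by exact: measurable_funD.
have p0 x : 0 <= `|h x| + h x by have := ler_norm (- h x); rewrite normrN; lra.
have ip : mu.-integrable setT (EFin \o (fun x => (`|h x| + h x) * normal_pdf m s x)).
  have := integrableD measurableT iah ih; apply: eq_integrable => // x _ /=.
  by rewrite mulrDl.
have iPp := ge0_int _ mp p0 ip.
have iPh : P.-integrable setT (EFin \o (h \o X)).
  have := integrableB measurableT iPp iPa; apply: eq_integrable => // w _ /=.
  by rewrite -EFinB addrAC subrr add0r.
split => //.
have -> : \int[P]_w h (X w) = \int[P]_w ((`|h (X w)| + h (X w)) - `|h (X w)|).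
  by apply: eq_Rintegral => w _; rewrite addrAC subrr add0r.
rewrite RintegralB//.
have -> : \int[P]_w (`|h (X w)| + h (X w)) = \int[mu]_x ((`|h x| + h x) * normal_pdf m s x).
  by rewrite /Rintegral (ge0_integral_normal_law mp p0).
have -> : \int[P]_w (`|h (X w)|) = \int[mu]_x (`|h x| * normal_pdf m s x).
  by rewrite /Rintegral (ge0_integral_normal_law mah (fun x => normr_ge0 _)).
rewrite -RintegralB//; apply: eq_Rintegral => x _.
by rewrite -mulrBl addrAC subrr add0r.
Qed.

End NormalLaw.

Section GaussianRV.
Context (R : realType) (dT : measure_display) (Omega : measurableType dT).
Variables (P : probability Omega R) (X : Omega -> R).

Lemma integral_dirac_law (m : R) (h : R -> R) : measurable_fun setT X ->
  (forall A : set (measurableTypeR R), measurable A -> P (X @^-1` A) = \d_m A) ->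
  measurable_fun setT h ->
  P.-integrable setT (EFin \o (h \o X)) /\ \int[P]_w h (X w) = h m.
Proof.
move=> mX lawX mh.
have ge0E (g : R -> R) : measurable_fun setT g -> (forall x, 0 <= g x) ->
    (\int[P]_w (g (X w))%:E = (g m)%:E)%E.
  move=> mg g0; have mg' : measurable_fun setT (EFin \o g) by exact/measurable_EFinP.
  have mX' : @measurable_fun _ _ Omega (measurableTypeR R) setT X by exact: mX.
  pose X' : {RV P >-> measurableTypeR R} :=
    @MeasurableFun.Pack _ _ _ (measurableTypeR R) X (MeasurableFun.Class
      (isMeasurableFun.Build _ _ _ (measurableTypeR R) X mX')).
  transitivity (\int[distribution P X']_x (EFin \o g) x)%E.
    by rewrite ge0_integral_distribution.
  transitivity (\int[@dirac _ (measurableTypeR R) m R]_x (EFin \o g) x)%E.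
    by apply: eq_measure_integral => A mA _; exact: lawX.
  by rewrite integral_dirac//= diracT mul1e.
have ge0_int (g : R -> R) : measurable_fun setT g -> (forall x, 0 <= g x) ->
    P.-integrable setT (EFin \o (g \o X)).
  move=> mg g0; apply/integrableP; split.
    by apply/measurable_EFinP; exact: measurableT_comp.
  under eq_integral do rewrite /= ger0_norm//.
  by rewrite ge0E// ltry.
have mah : measurable_fun setT (fun x => `|h x|) by exact: measurableT_comp.
have mp : measurable_fun setT (fun x => `|h x| + h x) by exact: measurable_funD.
have p0 x : 0 <= `|h x| + h x by have := ler_norm (- h x); rewrite normrN; lra.
have iPa := ge0_int _ mah (fun x => normr_ge0 _).
have iPp := ge0_int _ mp p0.
split.
  have := integrableB measurableT iPp iPa; apply: eq_integrable => // w _ /=.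
  by rewrite -EFinB addrAC subrr add0r.
have -> : \int[P]_w h (X w) = \int[P]_w ((`|h (X w)| + h (X w)) - `|h (X w)|).
  by apply: eq_Rintegral => w _; rewrite addrAC subrr add0r.
rewrite RintegralB// /Rintegral (ge0E _ mp p0) (ge0E _ mah (fun x => normr_ge0 _)).
by rewrite /= addrAC subrr add0r.
Qed.

(** Both cases of [gaussian_law] yield the same formulas, with [s = 0] for the point mass. For
    Gaussian vectors the law enters below only through them. *)
Lemma gaussian_rv_facts : gaussian_rv P X -> exists m s : R,
  [/\ P.-integrable setT (EFin \o X) /\ \int[P]_w X w = m,
      P.-integrable setT (EFin \o (fun w => (X w - m) ^+ 2)) /\
      \int[P]_w (X w - m) ^+ 2 = s ^+ 2
    & forall b, \int[P]_w cos (X w - m + b) = expR (- (s ^+ 2 / 2)) * cos b].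
Proof.
move=> [mX [m [s lawX]]]; exists m, s.
have msub : measurable_fun setT (fun x : R => x - m) by exact: measurable_funB.
have msqr : measurable_fun setT (fun x : R => (x - m) ^+ 2) by exact: measurable_funX.
have mcos b : measurable_fun setT (fun x : R => cos (x - m + b)).
  apply: measurableT_comp; first by apply: continuous_measurable_fun; exact: continuous_cos.
  exact: measurable_funD.
move: lawX; rewrite /gaussian_law; have [-> lawX|s0 lawX] := eqVneq s 0.
  have D h := @integral_dirac_law m h mX lawX.
  split; first exact: D.
  - have [i ->] := D _ msqr; split => //.
    by rewrite subrr.
  - move=> b; have [_ ->] := D _ (mcos b).
    by rewrite subrr add0r expr0n mul0r oppr0 expR0 mul1r.
have L h := @integral_normal_law R _ _ P X m s mX lawX h.
have dist1 (x : R) : `|x - m| <= 1 * exp_weight 1 (x - m).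
  by rewrite mul1r; have := exp_weight_ge 1 (x - m); rewrite mul1r.
have isub : lebesgue_measure.-integrable setT (EFin \o (fun x => (x - m) * normal_pdf m s x)).
  exact: (@integrable_gaussian_dominated _ _ _ s0 _ 1 1).
have isqr : lebesgue_measure.-integrable setT
    (EFin \o (fun x => (x - m) ^+ 2 * normal_pdf m s x)).
  apply: (@integrable_gaussian_dominated _ _ _ s0 _ 2 2) => // x.
  rewrite normrX expr2 (le_trans _ (exp_weightM _))//.
  by have := dist1 x; rewrite mul1r => h; apply: ler_pM.
have icos b : lebesgue_measure.-integrable setT
    (EFin \o (fun x => cos (x - m + b) * normal_pdf m s x)).
  apply: (@integrable_gaussian_dominated _ _ _ s0 _ 1 1) => // x.
  rewrite mul1r (le_trans _ (exp_weight_ge1 _ _))//.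
  by rewrite ler_norml cos_geN1 cos_le1.
split.
- have [i e] := L _ msub isub; rewrite gaussian_mean// in e.
  have icst : P.-integrable setT (EFin \o (fun _ : Omega => m)).
    by apply: (@integrable_bounded _ _ _ _ _ `|m|).
  have iX : P.-integrable setT (EFin \o X).
    have := integrableD measurableT i icst; apply: eq_integrable => // w _ /=.
    by rewrite -EFinD subrK.
  split => //; move: e; rewrite RintegralB// Rintegral_prob_cst.
  by move/eqP; rewrite subr_eq0 => /eqP.
- have [i ->] := L _ msqr isqr; split => //.
  exact: gaussian_variance.
- move=> b; have [_ ->] := L _ (mcos b) (icos b).
  have := gaussian_charfun m s0 1 b; rewrite expr1n mulr1 => <-.
  by apply: eq_Rintegral => x _; rewrite mul1r.
Qed.

End GaussianRV.

Section GaussianVector.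
Context (R : realType) (n : nat) (dT : measure_display) (Omega : measurableType dT).
Variables (P : probability Omega R) (J : {set 'I_n}) (G : 'I_n -> Omega -> R).
Variable S : 'I_n -> 'I_n -> R.
Hypothesis hG : centered_gaussian_vector P J G S.

Lemma gaussian_vector_component j : j \in J -> gaussian_rv P (G j).
Proof.
move=> jJ; have [h _ _] := hG; have := h (fun k => (k == j)%:R).
congr gaussian_rv; apply/funext => w.
rewrite (bigD1 j)//= eqxx mul1r big1 ?addr0// => k /andP[_ /negbTE ->].
by rewrite mul0r.
Qed.

Lemma gaussian_vector_measurable j : j \in J -> measurable_fun setT (G j).
Proof. by move=> /gaussian_vector_component[]. Qed.

Lemma gaussian_vector_integrable j : j \in J ->
  P.-integrable setT (EFin \o G j) /\ \int[P]_w G j w = 0.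
Proof.
move=> jJ; have [_ hE _] := hG.
have [m [s [[i _] _ _]]] := gaussian_rv_facts (gaussian_vector_component jJ).
split => //; have := hE j jJ; rewrite unlock => h.
by rewrite /Rintegral h.
Qed.

Lemma gaussian_vector_sqr_integrable j : j \in J ->
  P.-integrable setT (EFin \o (fun w => G j w ^+ 2)).
Proof.
move=> jJ; have [_ G0] := gaussian_vector_integrable jJ.
have [m [s [[_ hm] [i _] _]]] := gaussian_rv_facts (gaussian_vector_component jJ).
move: i; rewrite -hm G0; apply: eq_integrable => // w _ /=.
by rewrite subr0.
Qed.

(** Integrability comes from [|G l * G h| <= G l ^+ 2 + G h ^+ 2]; as the means vanish, the
    covariance is the plain integral of the product. *)
Lemma gaussian_vector_cross l h : l \in J -> h \in J ->
  P.-integrable setT (EFin \o (fun w => G l w * G h w)) /\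
  \int[P]_w (G l w * G h w) = S l h.
Proof.
move=> lJ hJ; have [_ hE hC] := hG.
have ml := gaussian_vector_measurable lJ; have mh := gaussian_vector_measurable hJ.
split.
  have iS : P.-integrable setT (EFin \o (fun w => G l w ^+ 2 + G h w ^+ 2)).
    exact: (integrableD measurableT (gaussian_vector_sqr_integrable lJ)
      (gaussian_vector_sqr_integrable hJ)).
  apply: le_integrable iS => //.
    by apply/measurable_EFinP; exact: measurable_funM.
  move=> w _; rewrite lee_fin.
  rewrite (ger0_norm (addr_ge0 (sqr_ge0 _) (sqr_ge0 _))) normrM.
  rewrite -(real_normK (num_real (G l w))) -(real_normK (num_real (G h w))).
  have := sqr_ge0 (`|G l w| - `|G h w|).
  by have := mulr_ge0 (normr_ge0 (G l w)) (normr_ge0 (G h w)); lra.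
have := hC l h lJ hJ; rewrite covariance.unlock (hE l lJ) (hE h hJ) /= unlock => H.
rewrite /Rintegral -[RHS]/(fine (S l h)%:E) -H; congr fine.
by apply: eq_integral => w _; rewrite mulrfctE /= !subr0.
Qed.

(** The linear combination is Gaussian with unknown parameters; linearity of the integral identifies
    its mean as 0 and its variance as the quadratic form of [S]. *)
Lemma gaussian_vector_charfun (c : 'I_n -> R) b :
  \int[P]_w cos (\sum_(j in J) c j * G j w + b) =
  expR (- ((\sum_(l in J) \sum_(h in J) c l * c h * S l h) / 2)) * cos b.
Proof.
have [hX _ _] := hG.
have [m [s [[_ hm] [_ hs] hcos]]] := gaussian_rv_facts (hX c).
have m0 : m = 0.
  have iG j : j \in J -> P.-integrable setT (EFin \o (fun w => c j * G j w)).
    by move=> jJ; exact: (integrableZl measurableT (c j) (gaussian_vector_integrable jJ).1).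
  rewrite -hm; have [_ ->] := integral_finite_sum (index_enum _) iG.
  rewrite big1// => j jJ; have [i e] := gaussian_vector_integrable jJ.
  by rewrite RintegralZl// e mulr0.
rewrite {}m0 in hs hcos.
suff sE : s ^+ 2 = \sum_(l in J) \sum_(h in J) c l * c h * S l h.
  have := hcos b; under eq_Rintegral do rewrite subr0.
  by rewrite sE.
rewrite -hs.
have -> : \int[P]_w (\sum_(j in J) c j * G j w - 0) ^+ 2 =
    \int[P]_w (\sum_(l in J) \sum_(h in J) c l * c h * (G l w * G h w)).
  apply: eq_Rintegral => w _; rewrite subr0 expr2 mulr_suml; apply: eq_bigr => l _.
  by rewrite mulr_sumr; apply: eq_bigr => h _; ring.
have icr l h : l \in J -> h \in J -> P.-integrable setT
    (EFin \o (fun w => c l * c h * (G l w * G h w))).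
  by move=> lJ hJ; exact: (integrableZl measurableT _ (gaussian_vector_cross lJ hJ).1).
have inner l (lJ : l \in J) := integral_finite_sum (index_enum _)
  (fun h (hJ : h \in J) => icr l h lJ hJ).
have [_ ->] := integral_finite_sum (index_enum _) (fun l lJ => (inner l lJ).1).
apply: eq_bigr => l lJ; rewrite (inner l lJ).2; apply: eq_bigr => h hJ.
have [i e] := gaussian_vector_cross lJ hJ.
by rewrite RintegralZl// e.
Qed.

End GaussianVector.

(** * Convergence in law of a maximum *)

Section MeasurableTrig.
Context (R : realType) (d : nat) (J : {set 'I_d}).
Context (dT : measure_display) (Omega : measurableType dT).
Variable Y : 'I_d -> Omega -> R.
Hypothesis mY : forall j, j \in J -> measurable_fun setT (Y j).

Lemma measurable_sum_in (c : 'I_d -> R) :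
  measurable_fun setT (fun w => \sum_(j in J) c j * Y j w).
Proof.
under eq_fun do rewrite big_mkcond.
apply: measurable_sum => j; have [jJ|_] := boolP (j \in J); last exact: measurable_cst.
by apply: measurable_funM => //; exact: mY.
Qed.

Lemma measurable_trig_poly h : trig_poly J h ->
  measurable_fun setT (fun w => h (Y ^~ w)).
Proof.
elim=> [c b|f g _ IH1 _ IH2|a f _ IH].
- apply: measurableT_comp; first by apply: continuous_measurable_fun; exact: continuous_cos.
  by apply: measurable_funD => //; exact: measurable_sum_in.
- exact: measurable_funD.
- exact: measurable_funM.
Qed.

(** A uniform limit of trigonometric polynomials is a pointwise limit of measurable functions along
    tolerances [1 / (n + 1)]. *)
Lemma measurable_uniform_closure_trig h : uniform_closure (@trig_poly R d J) h ->
  measurable_fun setT (fun w => h (Y ^~ w)).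
Proof.
move=> Uh.
have /choice[a ha] : forall n : nat, exists a, trig_poly J a /\
    forall x, `|h x - a x| <= n.+1%:R^-1.
  move=> n; have n0 : (0 : R) < n.+1%:R^-1 by rewrite invr_gt0.
  by have [a ta ha] := Uh _ n0; exists a.
apply: (@measurable_fun_cvg _ _ _ _ (fun n w => a n (Y ^~ w))).
  by move=> n; apply: measurable_trig_poly; exact: (ha n).1.
move=> w _; apply/cvgrPdist_le => e e0.
apply: filterS (nbhs_infty_ger e^-1) => n hn.
rewrite (le_trans ((ha n).2 _))// -[e]invrK lef_pV2 ?posrE ?invr_gt0//.
by rewrite (le_trans hn)// ler_nat.
Qed.

Lemma measurable_max_over : (exists j, j \in J) ->
  measurable_fun setT (fun w => max_over J (Y ^~ w)).
Proof.
move=> [j0 j0J]; under eq_fun do rewrite (max_overE _ j0J).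
elim: (index_enum _) => [|j r IH].
  by under eq_fun do rewrite big_nil; exact: mY.
under eq_fun do rewrite big_cons.
by have [jJ|//] := boolP (j \in J); apply: measurable_maxr => //; exact: mY.
Qed.

End MeasurableTrig.

Section Boxes.
Context (R : realType) (dT : measure_display) (Omega : measurableType dT).
Variable P : probability Omega R.

Lemma prob_bigsetU_le (I : Type) (r : seq I) (Q : pred I) (A : I -> set Omega) e :
  (forall i, Q i -> measurable (A i)) -> (forall i, Q i -> fine (P (A i)) <= e) ->
  0 <= e -> measurable (\big[setU/set0]_(i <- r | Q i) A i) /\
  fine (P (\big[setU/set0]_(i <- r | Q i) A i)) <= (size r)%:R * e.
Proof.
move=> mA PA e0; elim: r => [|i r [IH1 IH2]].
  by rewrite !big_nil measure0 mul0r.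
rewrite !big_cons /= -natr1 mulrDl mul1r; case: ifPn => Qi; last first.
  by split => //; rewrite (le_trans IH2)// lerDl.
split; first by apply: measurableU => //; exact: mA.
apply: (@le_trans _ _ (fine (P (A i)) +
    fine (P (\big[setU/set0]_(i <- r | Q i) A i)))); last first.
  by rewrite addrC lerD// PA.
rewrite -fineD ?fin_num_measure//; last exact: mA.
apply: fine_le.
- by rewrite fin_num_measure//; apply: measurableU => //; exact: mA.
- by rewrite fin_numD !fin_num_measure//; exact: mA.
- by apply: measureU2 => //; exact: mA.
Qed.

Lemma notin_box (d : nat) (J : {set 'I_d}) (Z : 'I_d -> Omega -> R) (B : R) w :
  ~ (\big[setU/set0]_(j in J) [set w | B < `|Z j w|]) w ->
  forall j, j \in J -> `|Z j w| <= B.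
Proof.
move=> h j jJ; rewrite leNgt; apply/negP => hj; apply: h.
by rewrite (bigD1 j)//=; left.
Qed.

End Boxes.

Section ConvergenceOfMax.
Context (R : realType) (d : nat) (J : {set 'I_d}).
Context (d1 : measure_display) (Omega : measurableType d1) (P : probability Omega R).
Context (d2 : measure_display) (Omega' : measurableType d2) (Q : probability Omega' R).
Variables (X : nat -> 'I_d -> Omega -> R) (G : 'I_d -> Omega' -> R).
Hypothesis J0 : exists j, j \in J.
Hypothesis mX : forall n j, measurable_fun setT (X n j).
Hypothesis mG : forall j, j \in J -> measurable_fun setT (G j).
Hypothesis X_tight : forall j e, 0 < e -> \forall B \near +oo, forall n : nat,
  fine (P [set w | B < `|X n j w|]) <= e.
Hypothesis charfun_cvg : forall (c : 'I_d -> R) b,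
  \int[P]_w cos (\sum_(j in J) c j * X n j w + b) @[n --> \oo] -->
  \int[Q]_w cos (\sum_(j in J) c j * G j w + b).

Let mXin n j (_ : j \in J) : measurable_fun setT (X n j) := mX n j.

Lemma trig_poly_cvg h : trig_poly J h ->
  \int[P]_w h (fun j => X n j w) @[n --> \oo] --> \int[Q]_w h (G ^~ w).
Proof.
elim=> [c b|f g tf IH1 tg IH2|a f tf IH]; first exact: charfun_cvg.
- have [M fM] := trig_poly_bounded tf; have [N gN] := trig_poly_bounded tg.
  have -> : \int[Q]_w (f (G ^~ w) + g (G ^~ w)) =
      \int[Q]_w f (G ^~ w) + \int[Q]_w g (G ^~ w).
    rewrite RintegralD//.
      by apply: (@integrable_bounded _ _ _ _ _ M); [exact: (measurable_trig_poly mG tf)|move=> w; exact: fM].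
    by apply: (@integrable_bounded _ _ _ _ _ N); [exact: (measurable_trig_poly mG tg)|move=> w; exact: gN].
  under eq_fun => n.
    rewrite RintegralD//; last 2 first.
    + apply: (@integrable_bounded _ _ _ _ _ M); last by move=> w; exact: fM.
      exact: (measurable_trig_poly (mXin n) tf).
    + apply: (@integrable_bounded _ _ _ _ _ N); last by move=> w; exact: gN.
      exact: (measurable_trig_poly (mXin n) tg).
    over.
  exact: cvgD.
- have [M fM] := trig_poly_bounded tf.
  have -> : \int[Q]_w (a * f (G ^~ w)) = a * \int[Q]_w f (G ^~ w).
    rewrite RintegralZl//.
    by apply: (@integrable_bounded _ _ _ _ _ M); [exact: (measurable_trig_poly mG tf)|move=> w; exact: fM].
  under eq_fun => n.
    rewrite RintegralZl//; last first.
      apply: (@integrable_bounded _ _ _ _ _ M); last by move=> w; exact: fM.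
      exact: (measurable_trig_poly (mXin n) tf).
    over.
  by apply: cvgM => //; exact: cvg_cst.
Qed.

Lemma uniform_closure_trig_cvg h : uniform_closure (@trig_poly R d J) h ->
  \int[P]_w h (fun j => X n j w) @[n --> \oo] --> \int[Q]_w h (G ^~ w).
Proof.
move=> Uh; apply/cvgrPdist_le => e e0.
have e3 : 0 < e / 3 by rewrite divr_gt0.
have [a ta ha] := Uh _ e3.
have [M1 hM1] := uniform_closure_bounded (@trig_poly_bounded R d J) Uh.
have [M2 aM2] := trig_poly_bounded ta.
pose M := Num.max M1 M2.
have hM x : `|h x| <= M by rewrite le_max hM1.
have aM x : `|a x| <= M by rewrite le_max aM2 orbT.
have /cvgrPdist_le /(_ _ e3) := trig_poly_cvg ta.
apply: filterS => n hn.
(* The approximation is uniform on the whole space, so the exceptional event is empty. *)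
have dist1 : `|\int[Q]_w h (G ^~ w) - \int[Q]_w a (G ^~ w)| <= e / 3.
  have := @Rintegral_dist_le _ _ _ Q (fun w => h (G ^~ w)) (fun w => a (G ^~ w)) M (e / 3) set0.
  rewrite measure0 mulr0 addr0; apply => //; last exact: ltW.
  - exact: (measurable_uniform_closure_trig mG Uh).
  - exact: (measurable_trig_poly mG ta).
have dist2 : `|\int[P]_w h (fun j => X n j w) - \int[P]_w a (fun j => X n j w)| <= e / 3.
  have := @Rintegral_dist_le _ _ _ P (fun w => h (fun j => X n j w))
    (fun w => a (fun j => X n j w)) M (e / 3) set0.
  rewrite measure0 mulr0 addr0; apply => //; last exact: ltW.
  - exact: (measurable_uniform_closure_trig (mXin n) Uh).
  - exact: (measurable_trig_poly (mXin n) ta).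
move: dist1 dist2 hn; rewrite !ler_norml => /andP[? ?] /andP[? ?] /andP[? ?].
by apply/andP; split; lra.
Qed.

(** The choices are made in the order [q], box size [B], approximant [h]; this is not circular
    because [h] inherits the bound [M], so the tail error is known before [h] is. *)
Lemma max_over_cvg (f : R -> R) M : continuous f -> (forall t, `|f t| <= M) ->
  \int[P]_w f (max_over J (fun j => X n j w)) @[n --> \oo] -->
  \int[Q]_w f (max_over J (G ^~ w)).
Proof.
move=> cf fM; apply/cvgrPdist_le => e e0.
have M0 : 0 <= M := le_trans (normr_ge0 _) (fM 0).
pose N : R := (size (index_enum 'I_d))%:R.
(* The union bound over [N] coordinates gives tail mass [N * q], at a cost
   [2 * M * (N * q) <= e / 8]. *)
pose q := e / (16 * (N + 1) * (M + 1)).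
have N0 : 0 <= N by exact: ler0n.
have K0 : 0 < 16 * (N + 1) * (M + 1) by rewrite !mulr_gt0// ltr_wpDl.
have q0 : 0 < q by rewrite divr_gt0.
have qe : 2 * M * (N * q) <= e / 8.
  have -> : e / 8 = 2 * ((N + 1) * (M + 1)) * q by rewrite /q; field; rewrite !gt_eqF// ltr_wpDl.
  have -> : 2 * M * (N * q) = 2 * (N * M) * q by ring.
  apply: ler_wpM2r; first exact: ltW.
  by have := mulr_ge0 N0 M0; lra.
have hXt : \forall B \near +oo, forall j (n : nat), fine (P [set w | B < `|X n j w|]) <= q.
  by apply: filter_forall => j; exact: X_tight.
have hGt : \forall B \near +oo, forall j, j \in J ->
    fine (Q [set w | B < `|G j w|]) <= q.
  apply: filter_forall => j; have [jJ|_] := boolP (j \in J); last exact: nearW.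
  by apply: filterS (tight_random_variable Q (mG jJ) q0) => B hB _.
have [B [B0 hXB hGB]] : exists B, [/\ 0 < B,
    forall j (n : nat), fine (P [set w | B < `|X n j w|]) <= q &
    forall j, j \in J -> fine (Q [set w | B < `|G j w|]) <= q].
  near (pinfty_nbhs R) => B; exists B; split.
  - by near: B; exact: nbhs_pinfty_gt.
  - by near: B.
  - by near: B.
have e8 : 0 < e / 8 by rewrite divr_gt0.
have [h [Uh hM happ]] := trig_approximation_of_max J0 cf fM B0 e8.
have [mBG PBG] := prob_bigsetU_le (index_enum _)
  (fun j jJ => measurable_norm_gt B (mG jJ)) hGB (ltW q0).
have /cvgrPdist_le /(_ _ e8) := uniform_closure_trig_cvg Uh.
apply: filterS => n hn.
have [mBX PBX] := prob_bigsetU_le (index_enum _)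
  (fun j (jJ : j \in J) => measurable_norm_gt B (mX n j)) (fun j _ => hXB j n) (ltW q0).
have tail_le (z : R) : z <= N * q -> e / 8 + 2 * M * z <= e / 8 + e / 8.
  by move=> zN; rewrite lerD2l (le_trans _ qe)// ler_wpM2l// mulr_ge0.
have dG : `|\int[Q]_w f (max_over J (G ^~ w)) - \int[Q]_w h (G ^~ w)| <= e / 8 + e / 8.
  apply: le_trans (tail_le _ PBG); apply: Rintegral_dist_le => //; last 2 first.
  - exact: ltW.
  - by move=> w /notin_box; exact: happ.
  - apply: measurableT_comp; first exact: continuous_measurable_fun.
    exact: (measurable_max_over mG J0).
  - exact: (measurable_uniform_closure_trig mG Uh).
have dX : `|\int[P]_w f (max_over J (fun j => X n j w)) -
    \int[P]_w h (fun j => X n j w)| <= e / 8 + e / 8.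
  apply: le_trans (tail_le _ PBX); apply: Rintegral_dist_le => //; last 2 first.
  - exact: ltW.
  - by move=> w /notin_box; exact: happ.
  - apply: measurableT_comp; first exact: continuous_measurable_fun.
    exact: (measurable_max_over (mXin n) J0).
  - exact: (measurable_uniform_closure_trig (mXin n) Uh).
move: dG dX hn; rewrite !ler_norml => /andP[? ?] /andP[? ?] /andP[? ?].
by apply/andP; split; lra.
Unshelve. all: by end_near. Qed.

End ConvergenceOfMax.

(** * The random spectral radius *)

Lemma cvg_maxr (R : realType) (u v : nat -> R) (x y : R) :
  u n @[n --> \oo] --> x -> v n @[n --> \oo] --> y ->
  Num.max (u n) (v n) @[n --> \oo] --> Num.max x y.
Proof.
move=> ux vy; rewrite maxr_absE.
have -> : (fun n => Num.max (u n) (v n)) = (fun n => (u n + v n + `|u n - v n|) / 2).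
  by apply/funext => n; rewrite maxr_absE.
apply: cvgM; last exact: cvg_cst.
by apply: cvgD; [exact: cvgD|exact: cvg_norm (cvgB ux vy)].
Qed.

Lemma cvg_bigmax (R : realType) (d : nat) (a : nat -> 'I_d -> R) (l : 'I_d -> R) (z : R) :
  (forall j, a n j @[n --> \oo] --> l j) ->
  \big[Num.max/z]_(j < d) a n j @[n --> \oo] --> \big[Num.max/z]_(j < d) l j.
Proof.
move=> al; elim: (index_enum _) => [|j r IH].
  rewrite big_nil; under eq_fun do rewrite big_nil.
  exact: cvg_cst.
rewrite big_cons; under eq_fun do rewrite big_cons.
exact: cvg_maxr.
Qed.

Lemma expR_taylor2 (R : realType) (x : R) : `|x| <= 2^-1 ->
  `|expR x - 1 - x| <= 2 * x ^+ 2.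
Proof.
move=> hx; have h1 := expR_le_quadratic hx; have h2 := expR_ge1Dx x.
by rewrite ger0_norm; lra.
Qed.

Section RandomSpectralRadius.
Context (R : realType) (m d : nat) (p : 'I_m -> R) (lam : 'I_m -> 'I_d -> R[i]).
Context (dT : measure_display) (Omega : measurableType dT).
Variables (P : probability Omega R) (idx : nat -> Omega -> 'I_m).
Variable rn : nat -> Omega -> R.
Hypothesis d0 : (0 < d)%N.
Hypothesis p0 : forall i, 0 <= p i.
Hypothesis p1 : \sum_i p i = 1.
Hypothesis lam0 : forall i j, lam i j != 0.
Hypothesis hidx : iid_indices P p idx.
Hypothesis rnE : forall n w, rn n w = \big[Num.max/0]_(j < d)
  expR ((\sum_(k < n) ln (cmod (lam (idx k w) j))) / n%:R).

Let J := argmax_set p lam.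
Let rinf := rho_inf p lam.
Let mu := mu_exp p lam.

Let y (j : 'I_d) (i : 'I_m) : R := ln (cmod (lam i j)) - mu j.

Let X n (j : 'I_d) (w : Omega) : R := partial_sum idx (y j) n w / Num.sqrt n%:R.

Lemma centered_log j : \sum_i p i * y j i = 0.
Proof.
under eq_bigr do rewrite mulrBr.
by rewrite sumrB -mulr_suml p1 mul1r subrr.
Qed.

Lemma Sigma_centered l h : Sigma p lam l h = \sum_i p i * y l i * y h i.
Proof.
have -> : \sum_i p i * y l i * y h i =
    \sum_i (p i * ln (cmod (lam i l)) * ln (cmod (lam i h))
      - mu h * (p i * ln (cmod (lam i l))) - mu l * (p i * y h i)).
  by apply: eq_bigr => i _; rewrite /y; ring.
rewrite !sumrB -!mulr_sumr centered_log mulr0 subr0 /Sigma mulrC.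
by rewrite -/(mu l) mulrC.
Qed.

Lemma sum_log n j w : (0 < n)%N ->
  (\sum_(k < n) ln (cmod (lam (idx k w) j))) / n%:R =
  mu j + partial_sum idx (y j) n w / n%:R.
Proof.
move=> n0; have nn : n%:R != 0 :> R by rewrite pnatr_eq0 -lt0n.
rewrite /partial_sum /y sumrB.
have -> : \sum_(k < n) mu j = mu j * n%:R by rewrite sumr_const card_ord mulr_natr.
by rewrite mulrBl mulfK// addrC subrK.
Qed.

Lemma argmax_setP j : reflect (forall k, mu k <= mu j) (j \in J).
Proof.
rewrite inE; apply: (iffP forallP) => h k; first by have := h k; rewrite ler_expR.
by rewrite ler_expR.
Qed.

Lemma rho_infE j : j \in J -> rinf = expR (mu j).
Proof.
move=> /argmax_setP jJ; rewrite /rinf /rho_inf (bigmax0_eq (j := j))//.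
- exact: expR_ge0.
- by move=> k; rewrite ler_expR.
Qed.

Lemma argmax_set_nonempty : exists j, j \in J.
Proof. by have [j hj] := exists_argmax mu d0; exists j; apply/argmax_setP. Qed.

Lemma rho_inf_gt0 : 0 < rinf.
Proof. by have [j jJ] := argmax_set_nonempty; rewrite (rho_infE jJ) expR_gt0. Qed.

Lemma rho_inf_prod :
  rinf = \big[Num.max/0]_(j < d) \prod_(i < m) (cmod (lam i j) `^ p i).
Proof.
apply: eq_bigr => j _; rewrite /rho_exp /mu_exp expR_sum; apply: eq_bigr => i _.
by rewrite /powR gt_eqF// cmod_gt0.
Qed.

Lemma rho_n_ae_cvg : {ae P, forall w, rn n w @[n --> \oo] --> rinf}.
Proof.
have h j := strong_law hidx p0 p1 (centered_log j).
have : {ae P, forall w, forall j, partial_sum idx (y j) n w / n%:R @[n --> \oo] --> (0 : R)}.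
  by apply: filter_forall => j; exact: h.
apply: filterS => w hw.
have : \big[Num.max/0]_(j < d) expR (mu j + partial_sum idx (y j) n w / n%:R) @[n --> \oo]
    --> \big[Num.max/0]_(j < d) expR (mu j).
  apply: cvg_bigmax => j.
  have H : mu j + partial_sum idx (y j) n w / n%:R @[n --> \oo] --> mu j + 0.
    by apply: cvgD; [exact: cvg_cst|exact: hw].
  rewrite addr0 in H.
  exact: (cvg_comp _ _ H (@continuous_expR R (mu j))).
apply: cvg_trans; apply: near_eq_cvg.
apply: filterS (nbhs_infty_gt 0) => n n0.
by rewrite rnE; apply: eq_bigr => j _; rewrite sum_log.
Qed.

Lemma measurable_rho_n n : measurable_fun setT (rn n).
Proof.
rewrite (_ : rn n = (fun g : {ffun 'I_n -> 'I_m} => \big[Num.max/0]_(j < d)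
    expR ((\sum_(k < n) ln (cmod (lam (g k) j))) / n%:R)) \o word idx n).
  exact: (measurable_word_fun hidx).
apply/funext => w /=; rewrite rnE; apply: eq_bigr => j _.
have -> // : \sum_(k < n) ln (cmod (lam (word idx n w k) j)) =
  \sum_(k < n) ln (cmod (lam (idx k w) j)).
by apply: eq_bigr => k _; rewrite ffunE.
Qed.

Lemma measurable_scaled_sum n j : measurable_fun setT (X n j).
Proof. by apply: measurable_funM => //; exact: (measurable_partial_sum hidx). Qed.

(** A linear combination of the coordinates is again a scaled sum, for the single centered function
    [v]; its variance is the quadratic form of [Sigma]. This reduces the vector case to
    [charfun_pow_cvg]. *)
Lemma scaled_sum_charfun_cvg (c : 'I_d -> R) b :
  \int[P]_w cos (\sum_(j in J) c j * X n j w + b) @[n --> \oo] -->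
  expR (- ((\sum_(l in J) \sum_(h in J) c l * c h * Sigma p lam l h) / 2)) * cos b.
Proof.
pose v i := \sum_(j in J) c j * y j i.
have pv : \sum_i p i * v i = 0.
  under eq_bigr do rewrite mulr_sumr.
  rewrite exchange_big /= big1// => j _.
  by under eq_bigr do rewrite mulrCA; rewrite -mulr_sumr centered_log mulr0.
have -> : \sum_(l in J) \sum_(h in J) c l * c h * Sigma p lam l h = \sum_i p i * v i ^+ 2.
  under [RHS]eq_bigr => i _.
    rewrite expr2 /v mulr_suml mulr_sumr.
    under eq_bigr do rewrite !mulr_sumr.
    over.
  rewrite /= [RHS]exchange_big /=; apply: eq_bigr => l _.
  rewrite [RHS]exchange_big /=; apply: eq_bigr => h _.
  by rewrite Sigma_centered mulr_sumr; apply: eq_bigr => i _; ring.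
have := charfun_pow_cvg p0 p1 pv (b := b).
under eq_fun do rewrite -(Rintegral_cos_partial_sum hidx).
apply: cvg_trans; apply: near_eq_cvg; apply: nearW => n.
apply: eq_Rintegral => w _.
have -> // : (Num.sqrt n%:R)^-1 * partial_sum idx v n w = \sum_(j in J) c j * X n j w.
rewrite /X /partial_sum /v exchange_big /= mulr_sumr; apply: eq_bigr => j _.
by rewrite -mulr_sumr; ring.
Qed.

(** Exponents outside [J] lag by a gap [gam], while on the box fluctuations are at most
    [B / sqrt n]; so for large [n] the index maximal within [J] is maximal overall, and exp can be
    expanded at this single index. *)
Lemma rho_n_expansion (B eta : R) : 0 < B -> 0 < eta ->
  \forall n \near \oo, forall w, (forall j, `|X n j w| <= B) ->
  `|Num.sqrt n%:R * (rn n w - rinf) - rinf * max_over J (fun j => X n j w)| <= eta.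
Proof.
move=> B0 eta0; have [j1 j1J] := argmax_set_nonempty.
have mu1 := argmax_setP _ j1J.
have rinf0 := rho_inf_gt0.
have [gam gam0 hgam] : exists2 gam, 0 < gam &
    forall k, k \notin J -> mu k <= mu j1 - gam.
  (* The default 1 serves the case where [J] contains every index. *)
  exists (\big[Num.min/1]_(k | k \notin J) (mu j1 - mu k)).
    apply: lt_bigmin => // k kJ; rewrite subr_gt0 lt_neqAle mu1 andbT.
    apply: contra kJ => /eqP kj; apply/argmax_setP => l; rewrite kj; exact: mu1.
  move=> k kJ; rewrite lerBrDl -lerBrDr.
  exact: (bigmin_le_cond 1 (fun k => mu j1 - mu k)).
have cvgs := @cvg_inv_sqrt R.
have cB : B * (Num.sqrt (n%:R : R))^-1 @[n --> \oo] --> B * 0.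
  by apply: cvgM => //; exact: cvg_cst.
have cE : rinf * 2 * B ^+ 2 * (Num.sqrt (n%:R : R))^-1 @[n --> \oo] --> rinf * 2 * B ^+ 2 * 0.
  by apply: cvgM => //; exact: cvg_cst.
rewrite !mulr0 in cB cE.
(* With [gam / 2], two opposite fluctuations cannot overcome the gap; [2^-1] is the range of
   [expR_taylor2]. *)
pose g2 := Num.min (gam / 2) 2^-1.
have g20 : 0 < g2 by rewrite lt_min divr_gt0//= invr_gt0.
have /cvgrPdist_le /(_ _ g20) nB := cB.
have /cvgrPdist_le /(_ _ eta0) nE := cE.
apply: filterS3 (nbhs_infty_gt 0) nB nE => n n0.
set r := Num.sqrt (n%:R : R).
have r0 : 0 < r by rewrite sqrtr_gt0 ltr0n.
have r2 : r * r = n%:R by rewrite -expr2 sqr_sqrtr.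
rewrite !sub0r !normrN => hB hE w wB.
have Br : B / r <= g2 by rewrite (le_trans (ler_norm _)).
have Brg : B / r <= gam / 2 by rewrite (le_trans Br)// ge_min lexx.
have Brh : B / r <= 2^-1 by rewrite (le_trans Br)// ge_min lexx orbT.
have [j2 [j2J -> hj2]] := max_overP (fun j => X n j w) argmax_set_nonempty.
have mu2 := argmax_setP _ j2J.
have mu21 : mu j2 = mu j1 by apply/le_anti; rewrite mu1 mu2.
have Xr j : `|X n j w / r| <= B / r.
  by rewrite normrM normfV (gtr0_norm r0) ler_pM2r ?invr_gt0.
have termE j : (\sum_(k < n) ln (cmod (lam (idx k w) j))) / n%:R = mu j + X n j w / r.
  by rewrite sum_log// /X -/r -mulrA -invfM r2.
have -> : rn n w = expR (mu j2 + X n j2 w / r).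
  rewrite rnE (bigmax0_eq (j := j2)) ?termE ?expR_ge0// => k.
  rewrite termE ler_expR; have [kJ|kJ] := boolP (k \in J).
    by rewrite lerD// ler_pM2r ?invr_gt0// hj2.
  have := hgam k kJ; have := Xr k; have := Xr j2; rewrite !ler_norml mu21.
  by move=> /andP[? _] /andP[_ ?] ?; lra.
rewrite expRD -(rho_infE j2J).
set z := X n j2 w / r.
have zE : X n j2 w = r * z by rewrite /z mulrCA divff ?mulr1// gt_eqF.
have -> : r * (rinf * expR z - rinf) - rinf * X n j2 w = r * rinf * (expR z - 1 - z).
  by rewrite zE; ring.
rewrite normrM (gtr0_norm (mulr_gt0 r0 rinf0)).
have zh : `|z| <= 2^-1 by rewrite (le_trans (Xr j2)).
rewrite (le_trans (ler_wpM2l _ (expR_taylor2 zh)))//.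
  by rewrite mulr_ge0// ltW.
apply: le_trans hE; rewrite (le_trans _ (ler_norm _))//.
have z2 : z ^+ 2 <= (B / r) ^+ 2.
  rewrite -real_normK ?num_real// lerXn2r ?nnegrE//; last exact: Xr.
  by rewrite divr_ge0// ltW.
have -> : rinf * 2 * B ^+ 2 / r = r * rinf * (2 * (B / r) ^+ 2).
  by field; rewrite gt_eqF.
by rewrite ler_wpM2l ?ler_wpM2l// mulr_ge0// ltW.
Qed.

Section Limit.
Context (d2 : measure_display) (Omega' : measurableType d2) (Q : probability Omega' R).
Variable G : 'I_d -> Omega' -> R.
Hypothesis mG : forall j, j \in J -> measurable_fun setT (G j).
Hypothesis G_charfun : forall (c : 'I_d -> R) b,
  \int[Q]_w cos (\sum_(j in J) c j * G j w + b) =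
  expR (- ((\sum_(l in J) \sum_(h in J) c l * c h * Sigma p lam l h) / 2)) * cos b.

Lemma scaled_sum_tight j e : 0 < e -> \forall B \near +oo, forall n : nat,
  fine (P [set w | B < `|X n j w|]) <= e.
Proof. exact: (scaled_partial_sum_tight hidx p0 p1 (centered_log j)). Qed.

Lemma max_scaled_sum_cvg (f : R -> R) M : continuous f -> (forall t, `|f t| <= M) ->
  \int[P]_w f (max_over J (fun j => X n j w)) @[n --> \oo] -->
  \int[Q]_w f (max_over J (G ^~ w)).
Proof.
apply: max_over_cvg => //.
- exact: argmax_set_nonempty.
- exact: measurable_scaled_sum.
- exact: scaled_sum_tight.
- by move=> c b; rewrite G_charfun; exact: scaled_sum_charfun_cvg.
Qed.

Lemma scaled_rho_n_cvg (f : R -> R) M : continuous f -> (forall t, `|f t| <= M) ->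
  \int[P]_w f (Num.sqrt n%:R * (rn n w - rinf)) @[n --> \oo] -->
  \int[Q]_w f (rinf * max_over J (G ^~ w)).
Proof.
move=> cf fM; have rinf0 := rho_inf_gt0.
have cf' : continuous (fun t => f (rinf * t)).
  move=> t; apply: (continuous_comp (f := fun t => rinf * t)); last exact: cf.
  by apply: cvgM; [exact: cvg_cst|exact: cvg_id].
have lim := max_scaled_sum_cvg cf' (fun t => fM (rinf * t)).
apply/cvgrPdist_le => e e0.
have M0 : 0 <= M := le_trans (normr_ge0 _) (fM 0).
have e4 : 0 < e / 4 by rewrite divr_gt0.
pose N : R := (size (index_enum 'I_d))%:R.
have N0 : 0 <= N by exact: ler0n.
pose q := e / (8 * (N + 1) * (M + 1)).
have q0 : 0 < q by rewrite divr_gt0// !mulr_gt0// ltr_wpDl.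
have qe : 2 * M * (N * q) <= e / 4.
  have -> : e / 4 = 2 * ((N + 1) * (M + 1)) * q by rewrite /q; field; rewrite !gt_eqF// ltr_wpDl.
  have -> : 2 * M * (N * q) = 2 * (N * M) * q by ring.
  apply: ler_wpM2r; first exact: ltW.
  by have := mulr_ge0 N0 M0; lra.
have [B [B0 hXB]] : exists B, 0 < B /\
    forall j (n : nat), fine (P [set w | B < `|X n j w|]) <= q.
  have hXt : \forall B \near +oo, forall j (n : nat), fine (P [set w | B < `|X n j w|]) <= q.
    by apply: filter_forall => j; exact: scaled_sum_tight.
  near (pinfty_nbhs R) => B; exists B; split; near: B => //.
  exact: nbhs_pinfty_gt.
have [de de0 hde] := uniform_continuity_segment (rinf * B) cf e4.
have /cvgrPdist_le /(_ _ e4) := lim.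
apply: filterS2 (rho_n_expansion B0 de0) => n hn hlim.
(* The box constrains all [d] coordinates and not only those in [J]: the expansion must also keep
   the other indices from overtaking. *)
have [mBX PBX] := prob_bigsetU_le (index_enum _)
  (fun j (_ : j \in [set: 'I_d]%SET) => measurable_norm_gt B (measurable_scaled_sum n j))
  (fun j _ => hXB j n) (ltW q0).
have dX : `|\int[P]_w f (Num.sqrt n%:R * (rn n w - rinf)) -
    \int[P]_w f (rinf * max_over J (fun j => X n j w))| <= e / 4 + e / 4.
  have tl : e / 4 + 2 * M * (N * q) <= e / 4 + e / 4 by rewrite lerD2l.
  apply: le_trans tl; apply: le_trans (lerD (lexx _) (ler_wpM2l _ PBX)); last first.
    by rewrite mulr_ge0.
  apply: Rintegral_dist_le => //; last 2 first.
  - exact: ltW.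
  - move=> w /notin_box wB.
    have wB' j : `|X n j w| <= B by apply: wB; rewrite finset.in_setT.
    apply: hde; last exact: hn.
    have [j [jJ -> _]] := max_overP (fun j => X n j w) argmax_set_nonempty.
    by rewrite normrM (gtr0_norm rinf0) ler_pM2l.
  - apply: measurableT_comp; first exact: continuous_measurable_fun.
    by apply: measurable_funM => //; apply: measurable_funB => //; exact: measurable_rho_n.
  - apply: measurableT_comp; first exact: continuous_measurable_fun.
    apply: measurable_funM => //.
    exact: (measurable_max_over (fun j _ => measurable_scaled_sum n j) argmax_set_nonempty).
move: dX hlim; rewrite !ler_norml => /andP[? ?] /andP[? ?].
by apply/andP; split; lra.
Unshelve. all: by end_near. Qed.

(** The limit is specified by its characteristic function alone, so the same statement serves a
    Gaussian vector, a multiple of one standard normal variable, and the zero vector. *)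
Lemma scaled_rho_n_cvg_in_distribution :
  cvg_in_distribution P (fun n w => Num.sqrt n%:R * (rn n w - rinf))
    Q (fun w => rinf * max_over J (G ^~ w)).
Proof.
have mX n : measurable_fun setT (fun w => Num.sqrt n%:R * (rn n w - rinf)).
  by apply: measurable_funM => //; apply: measurable_funB => //; exact: measurable_rho_n.
have mY : measurable_fun setT (fun w => rinf * max_over J (G ^~ w)).
  by apply: measurable_funM => //; exact: (measurable_max_over mG argmax_set_nonempty).
split => // f cf [M fM].
have mf : measurable_fun setT f by exact: continuous_measurable_fun.
rewrite (@expectationE_bounded _ _ _ Q _ M) => [||w]; [|exact: measurableT_comp|exact: fM].
under eq_fun => n.
  rewrite (@expectationE_bounded _ _ _ P _ M) => [||w]; [|exact: measurableT_comp|exact: fM].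
  over.
apply: cvg_EFin; first exact: nearW.
exact: (scaled_rho_n_cvg cf fM).
Qed.

End Limit.

End RandomSpectralRadius.

Lemma normal_prob01_charfun (R : realType) (t b : R) :
  \int[normal_prob 0 1 : probability (measurableTypeR R) R]_x cos (t * x + b) =
  expR (- (t ^+ 2 / 2)) * cos b.
Proof.
have n10 : (1 : R) != 0 by exact: oner_neq0.
have mcos : measurable_fun setT (fun x : R => cos (t * x + b)).
  apply: measurableT_comp; first by apply: continuous_measurable_fun; exact: continuous_cos.
  by apply: measurable_funD => //; exact: measurable_funM.
have icos : lebesgue_measure.-integrable setT
    (EFin \o (fun x : R => cos (t * x + b) * normal_pdf 0 1 x)).
  apply: (@integrable_gaussian_dominated _ _ _ n10 _ 1 1) => // x.
  rewrite mul1r (le_trans _ (exp_weight_ge1 _ _))//.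
  by rewrite ler_norml cos_geN1 cos_le1.
have [_] := @integral_normal_law R _ (measurableTypeR R)
  (normal_prob 0 1 : probability (measurableTypeR R) R) (fun x => x) 0 1
  (@measurable_id _ _ setT) (fun _ _ => erefl) _ mcos icos.
move=> ->; have := gaussian_charfun 0 n10 t b.
rewrite expr1n mul1r => <-; apply: eq_Rintegral => x _.
by rewrite subr0.
Qed.

(** * A single maximal exponent: normal and degenerate limits *)

Section UniqueMaximum.
Context (R : realType) (m d : nat) (p : 'I_m -> R) (lam : 'I_m -> 'I_d -> R[i]).
Context (dT : measure_display) (Omega : measurableType dT).
Variables (P : probability Omega R) (idx : nat -> Omega -> 'I_m).
Variable rn : nat -> Omega -> R.
Hypothesis d0 : (0 < d)%N.
Hypothesis p0 : forall i, 0 <= p i.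
Hypothesis p1 : \sum_i p i = 1.
Hypothesis hidx : iid_indices P p idx.
Hypothesis rnE : forall n w, rn n w = \big[Num.max/0]_(j < d)
  expR ((\sum_(k < n) ln (cmod (lam (idx k w) j))) / n%:R).
Variable jstar : 'I_d.
Hypothesis hJ : argmax_set p lam = finset.set1 jstar.

Let rinf := rho_inf p lam.
Let s := sigma_inf p lam jstar.

Lemma sigma_infE : s = rinf * Num.sqrt (Sigma p lam jstar jstar).
Proof.
rewrite /s /sigma_inf /Sigma expr2; have -> // : \sum_(i < m) p i * ln (cmod (lam i jstar)) ^+ 2 =
  \sum_(i < m) p i * ln (cmod (lam i jstar)) * ln (cmod (lam i jstar)).
by apply: eq_bigr => i _; rewrite expr2 mulrA.
Qed.

Lemma Sigma_diag_ge0 : 0 <= Sigma p lam jstar jstar.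
Proof.
rewrite Sigma_centered//; apply: sumr_ge0 => i _.
by rewrite -mulrA mulr_ge0// -expr2 sqr_ge0.
Qed.

Let max_over1 (g : 'I_d -> R) : max_over (argmax_set p lam) g = g jstar.
Proof.
rewrite hJ; apply: max_over_eq; first by rewrite finset.in_set1.
by move=> k; rewrite finset.in_set1 => /eqP ->.
Qed.

Let quadratic1 (c : 'I_d -> R) :
  \sum_(l in argmax_set p lam) \sum_(h in argmax_set p lam) c l * c h * Sigma p lam l h =
  c jstar ^+ 2 * Sigma p lam jstar jstar.
Proof. by rewrite hJ !finset.big_set1 expr2. Qed.

Lemma rho_n_clt_normal : 0 < s ->
  cvg_in_distribution P (fun n w => (rn n w - rinf) / ((Num.sqrt n%:R)^-1 * s))
    (normal_prob 0 1 : probability (measurableTypeR R) R) idfun.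
Proof.
move=> s0; pose Q : probability (measurableTypeR R) R := normal_prob 0 1.
pose sg := Num.sqrt (Sigma p lam jstar jstar).
have sE : s = rinf * sg := sigma_infE.
have sg2 : sg ^+ 2 = Sigma p lam jstar jstar by rewrite sqr_sqrtr// Sigma_diag_ge0.
(* All components coincide, which is harmless since only [jstar] belongs to the argmax set. *)
pose G (j : 'I_d) (x : measurableTypeR R) : R := sg * x.
have mG j : j \in argmax_set p lam -> measurable_fun setT (G j).
  by move=> _; exact: measurable_funM.
have charG (c : 'I_d -> R) b :
    \int[Q]_w cos (\sum_(j in argmax_set p lam) c j * G j w + b) =
    expR (- ((\sum_(l in argmax_set p lam) \sum_(h in argmax_set p lam)
      c l * c h * Sigma p lam l h) / 2)) * cos b.
  rewrite quadratic1 -sg2 -exprMn -normal_prob01_charfun.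
  by apply: eq_Rintegral => x _; rewrite hJ finset.big_set1 mulrA.
have [mX mY lim] := scaled_rho_n_cvg_in_distribution d0 p0 p1 hidx rnE mG charG.
have XE n w : (rn n w - rinf) / ((Num.sqrt n%:R)^-1 * s) = Num.sqrt n%:R * (rn n w - rinf) / s.
  by rewrite invfM invrK; ring.
split.
- move=> n; under eq_fun do rewrite XE.
  by apply: measurable_funM => //; exact: mX.
- exact: measurable_id.
(* Division by [s] is moved into the test function. *)
move=> f cf [M fM]; pose f' (z : R) := f (z / s).
have cf' : continuous (fun z : R => f (z / s)).
  move=> z; apply: (continuous_comp (f := fun z : R => z / s)); last exact: cf.
  by apply: cvgM; [exact: cvg_id|exact: cvg_cst].
have := lim f' cf' (ex_intro _ M (fun z => fM (z / s))).
have -> : f' \o (fun x => rho_inf p lam * max_over (argmax_set p lam) (G ^~ x)) = f \o idfun.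
  apply/funext => x; rewrite /= /f' max_over1 /G mulrA -sE mulrAC divff ?mul1r//.
  by rewrite gt_eqF.
have -> // : (fun n => 'E_P[(f' \o (fun w => Num.sqrt n%:R * (rn n w - rho_inf p lam)))%R]%E) =
    (fun n => 'E_P[(f \o (fun w => (rn n w - rinf) / ((Num.sqrt n%:R)^-1 * s)))%R]%E).
apply/funext => n; have -> // : f' \o (fun w => Num.sqrt n%:R * (rn n w - rho_inf p lam)) =
  f \o (fun w => (rn n w - rinf) / ((Num.sqrt n%:R)^-1 * s)).
by apply/funext => w; rewrite /= XE.
Qed.

Lemma rho_n_clt_degenerate : s = 0 ->
  cvg_in_distribution P (fun n w => Num.sqrt n%:R * (rn n w - rinf)) P (fun=> 0).
Proof.
move=> s0; have V0 : Sigma p lam jstar jstar = 0.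
  move: s0; rewrite sigma_infE => /eqP; rewrite mulf_eq0 gt_eqF ?rho_inf_gt0//=.
  (* [Num.sqrt] vanishes on all nonpositive reals, so nonnegativity of the variance is what forces
     it to be 0. *)
  by rewrite sqrtr_eq0 => h; apply/le_anti; rewrite h Sigma_diag_ge0.
pose G (j : 'I_d) (w : Omega) : R := 0.
have mG j : j \in argmax_set p lam -> measurable_fun setT (G j).
  by move=> _; exact: measurable_cst.
have charG (c : 'I_d -> R) b :
    \int[P]_w cos (\sum_(j in argmax_set p lam) c j * G j w + b) =
    expR (- ((\sum_(l in argmax_set p lam) \sum_(h in argmax_set p lam)
      c l * c h * Sigma p lam l h) / 2)) * cos b.
  rewrite quadratic1 V0 mulr0 mul0r oppr0 expR0 mul1r.
  rewrite -[RHS](Rintegral_prob_cst P); apply: eq_Rintegral => w _.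
  by rewrite hJ finset.big_set1 mulr0 add0r.
have := scaled_rho_n_cvg_in_distribution d0 p0 p1 hidx rnE mG charG.
have -> // : (fun w => rho_inf p lam * max_over (argmax_set p lam) (G ^~ w)) = (fun=> 0).
by apply/funext => w; rewrite max_over1 mulr0.
Qed.

End UniqueMaximum.

Lemma sum_weights_gt0 (R : realType) (m : nat) (p : 'I_m -> R) :
  \sum_(i < m) p i = 1 -> (0 < m)%N.
Proof.
case: m p => // p; rewrite big_ord0 => /eqP.
by rewrite eq_sym oner_eq0.
Qed.

Theorem theorem10 (R : realType) (m d : nat)
    (A Delta : 'I_m -> 'M[R[i]]_d) (lambda : 'I_m -> 'I_d -> R[i])
    (p : 'I_m -> R)
    (hDelta : forall i, frobenius_norm (Delta i) = 1)
    (hlambda : forall i, simple_eigenvalues (A i) (lambda i))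
    (hlambda_neq0 : forall i j, lambda i j != 0)
    (hp_ge0 : forall i, 0 <= p i)
    (hp_sum : \sum_(i < m) p i = 1)
    (eps0 : R) (heps0 : 0 < eps0)
    (S : R -> 'M[R[i]]_d)
    (hS : forall e, `|e| <= eps0 -> S e \in unitmx)
    (T : R -> 'I_m -> 'M[R[i]]_d)
    (hT : forall e i, `|e| <= eps0 ->
       T e i = invmx (S e) *m perturb (A i) (Delta i) e *m S e)
    (hT_upper : forall e i, `|e| <= eps0 -> upper_triangular (T e i))
    (lam : R -> 'I_m -> 'I_d -> R[i])
    (hlam : forall e i j, `|e| <= eps0 -> lam e i j = T e i j j)
    (hlam0 : forall i j, lam 0 i j = lambda i j)
    (hlam_branch : forall i j, exists f : R -> R[i],
       analytic_eigenbranch (perturb (A i) (Delta i)) (lambda i j) f /\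
       \forall e \near (0 : R), lam e i j = f e)
    (hlam_neq0 : forall e i j, `|e| <= eps0 -> lam e i j != 0)
    (dO : measure_display) (Omega : measurableType dO)
    (P : probability Omega R) (idx : nat -> Omega -> 'I_m)
    (hidx : iid_indices P p idx)
    (eps : R) (heps : `|eps| <= eps0) :
  let rn := rho_n (fun i => perturb (A i) (Delta i) eps) idx in
  let rinf := rho_inf p (lam eps) in
  let J := argmax_set p (lam eps) in
  (* 1 *)
  ({ae P, forall w, rn n w @[n --> \oo] --> rinf} /\
   rinf = \big[Num.max/0]_(j < d) \prod_(i < m) (cmod (lam eps i j) `^ p i)) /\
  (* 2 *)
  (forall jstar : 'I_d, J = finset.set1 jstar ->
     let s := sigma_inf p (lam eps) jstar in
     (0 < s ->
        cvg_in_distribution P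
          (fun n w => (rn n w - rinf) / ((Num.sqrt n%:R)^-1 * s))
          (normal_prob 0 1 : probability (measurableTypeR R) R) idfun) /\
     (s = 0 ->
        cvg_in_distribution P
          (fun n w => Num.sqrt n%:R * (rn n w - rinf))
          P (fun=> 0))) /\
  (* 3 *)
  ((1 < #|J|)%N ->
     forall (dG : measure_display) (OmegaG : measurableType dG)
       (PG : probability OmegaG R) (G : 'I_d -> OmegaG -> R),
       centered_gaussian_vector PG J G (Sigma p (lam eps)) ->
       cvg_in_distribution P
         (fun n w => Num.sqrt n%:R * (rn n w - rinf))
         PG (fun w => rinf * max_over J (fun j => G j w))).
Proof.
move=> rn rinf J.
(* For [d = 0] the Frobenius norm is an empty sum, contradicting norm 1; an index [i0] exists
   because the weights sum to 1. *)
have d0 : (0 < d)%N.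
  have i0 := Ordinal (sum_weights_gt0 hp_sum).
  rewrite lt0n; apply/negP => /eqP dE.
  have := hDelta i0; rewrite /frobenius_norm big1 ?sqrtr0.
    by move/eqP; rewrite eq_sym oner_eq0.
  by move=> a _; exfalso; case: a => a; rewrite dE.
have rnE n w : rn n w = \big[Num.max/0]_(j < d)
    expR ((\sum_(k < n) ln (cmod (lam eps (idx k w) j))) / n%:R).
  rewrite /rn (@rho_nE _ _ _ d0 _ _ _ (T eps) (S eps))//.
  - apply: eq_bigr => j _.
    have -> // : \sum_(k < n) ln (cmod (T eps (idx k w) j j)) =
      \sum_(k < n) ln (cmod (lam eps (idx k w) j)).
    by apply: eq_bigr => k _; rewrite hlam.
  - exact: hS.
  - by move=> i; exact: hT.
  - by move=> i; exact: hT_upper.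
  - by move=> i j; rewrite -hlam// hlam_neq0.
split; [split|split].
- exact: (rho_n_ae_cvg hp_ge0 hp_sum hidx rnE).
- by apply: rho_inf_prod => i j; exact: hlam_neq0.
- move=> jstar hJ s; split.
  + exact: (rho_n_clt_normal d0 hp_ge0 hp_sum hidx rnE hJ).
  + exact: (rho_n_clt_degenerate d0 hp_ge0 hp_sum hidx rnE hJ).
- move=> _ dG OmegaG PG G hG.
  apply: (scaled_rho_n_cvg_in_distribution d0 hp_ge0 hp_sum hidx rnE).
  + by move=> j; exact: (gaussian_vector_measurable hG).
  + exact: (gaussian_vector_charfun hG).
Qed.
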